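(* Let $\rho$ be a $3$-representation of a group $G$ in a strict $3$-category $\mathcal{C}$, acting on the object $x$ of $\mathcal{C}$, let $f\in G$, and let $C_G(f)$ be the centralizer of $f$ in $G$. Then the functors $\psi_g:\mathbb{T}r_2\rho_f\to\mathbb{T}r_2\rho_f$ ($g\in C_G(f)$) and the natural transformations $\Gamma_{h,g}:\psi_h\circ\psi_g\to\psi_{hg}$ ($g,h\in C_G(f)$) constructed in the context form a categorical action $\{\psi_g,\Gamma_{h,g}\}_{g,h\in C_G(f)}$ of the group $C_G(f)$ on the category $\mathbb{T}r_2\rho_f$.
   Context: **Strict $3$-categories.** $\#_p$ denotes composition of arrows along a common $p$-dimensional boundary, written in natural (diagrammatic) order: $\alpha\#_p\beta$ is defined when the $p$-target of $\alpha$ is the $p$-source of $\beta$. For a $1$-arrow $A$ and a $2$- or $3$-arrow $\alpha$, $A\#_0\alpha$ and $\alpha\#_0A$ denote whiskering (composition with identities of $A$); similarly $\gamma\#_1\Theta$, $\Theta\#_1\gamma$ for a $2$-arrow $\gamma$ and a $3$-arrow $\Theta$. A $1$-arrow $B:x\to y$ is a $1$-isomorphism if there are a $1$-arrow $C:y\to x$ and $2$-isomorphisms $1_y\Rightarrow C\#_0B$, $1_x\Rightarrow B\#_0C$. A $2$- or $3$-arrow is a $2$- or $3$-isomorphism if it is strictly invertible (for $\#_1$, resp. $\#_2$). We write $\rho_h\rho_g$ for $\rho_h\#_0\rho_g$. **$3$-representation** of a group $G$ in a strict $3$-category $\mathcal{C}$: an object $x$; for each $g\in G$ a $1$-isomorphism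 $\rho_g:x\to x$; for all $h,g$ a $2$-isomorphism $\phi_{h,g}:\rho_h\rho_g\Rightarrow\rho_{hg}$; for all $g_3,g_2,g_1$ a $3$-isomorphism (associator) $$\Phi_{g_3,g_2,g_1}:(\rho_{g_3}\#_0\phi_{g_2,g_1})\#_1\phi_{g_3,g_2g_1}\longrightarrow(\phi_{g_3,g_2}\#_0\rho_{g_1})\#_1\phi_{g_3g_2,g_1};$$ and a $2$-isomorphism $\phi_1:\rho_1\Rightarrow1_x$, such that $\phi_{1,g}=\phi_1\#_0\rho_g$, $\phi_{g,1}=\rho_g\#_0\phi_1$, and the $3$-cocycle condition holds for all $g_4,g_3,g_2,g_1\in G$: $$\{[\rho_{g_4}\#_0\Phi_{g_3,g_2,g_1}]\#_1\phi_{g_4,g_3g_2g_1}\}\#_2\{[\rho_{g_4}\#_0\phi_{g_3,g_2}\#_0\rho_{g_1}]\#_1\Phi_{g_4,g_3g_2,g_1}\}\#_2\{[\Phi_{g_4,g_3,g_2}\#_0\rho_{g_1}]\#_1\phi_{g_4g_3g_2,g_1}\}$$ $$=\{[(\rho_{g_4}\rho_{g_3})\#_0\phi_{g_2,g_1}]\#_1\Phi_{g_4,g_3,g_2g_1}\}\#_2\{[\phi_{g_4,g_3}\#_0(\rho_{g_2}\rho_{g_1})]\#_1\Phi_{g_4g_3,g_2,g_1}\}.$$ Standing assumption: $\rho_1=1_x$ and $\phi_1$ is the identity (so $\phi_{1,g}$ and $\phi_{g,1}$ are identities). **$2$-categorical trace.** $\mathbb{T}r_2\rho_f$ is the category whose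 objects are the $2$-arrows $\chi:1_x\Rightarrow\rho_f$ of $\mathcal{C}$, whose morphisms are the $3$-arrows of $\mathcal{C}$ between them, with composition $\#_2$. **The functors $\psi_g$.** Write $g^*=g^{-1}$ and $u_g=\phi_{g,g^*}^{-1}:1_x\Rightarrow\rho_g\rho_{g^*}$. For $g\in C_G(f)$ and $\omega$ an object or a morphism of $\mathbb{T}r_2\rho_f$, $$\psi_g(\omega)=u_g\#_1[\rho_g\#_0\omega\#_0\rho_{g^*}]\#_1[\phi_{g,f}\#_0\rho_{g^*}]\#_1\phi_{gf,g^*}$$ (note $gfg^*=f$). **The transformations $\Gamma_{h,g}$.** Let $g,h\in C_G(f)$. For $e\in\{f,1\}$ put $$L^e=[\rho_h\#_0\phi_{g,e}\#_0(\rho_{g^*}\rho_{h^*})]\#_1[\rho_h\#_0\phi_{ge,g^*}\#_0\rho_{h^*}]\#_1[\phi_{h,geg^*}\#_0\rho_{h^*}]\#_1\phi_{hgeg^*,h^*},$$ $$R^e=[\phi_{h,g}\#_0(\rho_e\rho_{g^*}\rho_{h^*})]\#_1[\phi_{hg,e}\#_0(\rho_{g^*}\rho_{h^*})]\#_1[\rho_{hge}\#_0\phi_{g^*,h^*}]\#_1\phi_{hge,g^*h^*},$$ both $2$-isomorphisms $\rho_h\rho_g\rho_e\rho_{g^*}\rho_{h^*}\Rightarrow\rho_e$, and let $\Lambda^e=\Lambda_1^e\#_2\Lambda_2^e\#_2\Lambda_3^e:L^e\to R^e$ be the $3$-isomorphism with $$\Lambda_1^e=[\rho_h\#_0\phi_{g,e}\#_0(\rho_{g^*}\rho_{h^*})]\#_1[\Phi_{h,ge,g^*}\#_0\rho_{h^*}]\#_1\phi_{hgeg^*,h^*},$$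 $$\Lambda_2^e=[\Phi_{h,g,e}\#_0(\rho_{g^*}\rho_{h^*})]\#_1[\phi_{hge,g^*}\#_0\rho_{h^*}]\#_1\phi_{hgeg^*,h^*},$$ $$\Lambda_3^e=[\phi_{h,g}\#_0(\rho_e\rho_{g^*}\rho_{h^*})]\#_1[\phi_{hg,e}\#_0(\rho_{g^*}\rho_{h^*})]\#_1\Phi^{-1}_{hge,g^*,h^*}.$$ Let $(\Lambda^1)^\dagger=(L^1)^{-1}\#_1(\Lambda^1)^{-1}\#_1(R^1)^{-1}:(L^1)^{-1}\to(R^1)^{-1}$ be the adjoint of $\Lambda^1$, where $(\Lambda^1)^{-1}$ is the $\#_2$-inverse. For an object $\chi$ of $\mathbb{T}r_2\rho_f$, $$\Gamma_{h,g}(\chi)=(\Lambda^1)^\dagger\#_1[(\rho_h\rho_g)\#_0\chi\#_0(\rho_{g^*}\rho_{h^*})]\#_1\Lambda^f,$$ a $3$-isomorphism from $(L^1)^{-1}\#_1[(\rho_h\rho_g)\#_0\chi\#_0(\rho_{g^*}\rho_{h^*})]\#_1L^f=\psi_h(\psi_g(\chi))$ to $(R^1)^{-1}\#_1[(\rho_h\rho_g)\#_0\chi\#_0(\rho_{g^*}\rho_{h^*})]\#_1R^f=\psi_{hg}(\chi)$. **Categorical action** of a group $K$ on a category $\mathcal{W}$: functors $\psi_g:\mathcal{W}\to\mathcal{W}$ ($g\in K$) that are equivalences, and natural isomorphisms $\Gamma_{h,g}:\psi_h\circ\psi_g\to\psi_{hg}$, such that for all $k,h,g\in K$ one has the associativity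 $$\Gamma_{k,hg}\,\#\,(\psi_k\circ\Gamma_{h,g})=\Gamma_{kh,g}\,\#\,(\Gamma_{k,h}\circ\psi_g):\psi_k\circ\psi_h\circ\psi_g\to\psi_{khg}$$ (here $\#$ is composition of natural transformations in the usual order, the right factor applied first), and such that there is a natural isomorphism $\iota:\psi_1\to\mathrm{id}_{\mathcal{W}}$ with $\Gamma_{1,g}=\iota\circ\psi_g$ and $\Gamma_{g,1}=\psi_g\circ\iota$ for all $g\in K$. *)

(* Defs.v *)
From HB Require Import structures.
From mathcomp Require Import all_boot.
From Stdlib Require Import Classical ClassicalEpsilon.

Set Implicit Arguments.
Unset Strict Implicit.
Unset Printing Implicit Defensive.

Local Open Scope group_scope.

(* A strict 3-category is a 3-globular set with composition operations
    [#p] on [n]-arrows ([p < n <= 3]) such that [p]- and [n]-arrows form a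
    category for all [p < n], and [p]-, [q]- and [n]-arrows form a strict
    2-category for all [p < q < n].  Compositions are written in diagrammatic
    order.  They are total functions, but nothing is assumed about their value
    outside the composable pairs, so this is the same as partially defined
    compositions. *)

Record category_laws (O A : Type) (s t : A -> O) (i : O -> A)
    (c : A -> A -> A) : Prop := {
  law_src_id : forall x, s (i x) = x;
  law_tgt_id : forall x, t (i x) = x;
  law_src_comp : forall a b, t a = s b -> s (c a b) = s a;
  law_tgt_comp : forall a b, t a = s b -> t (c a b) = t b;
  law_assoc : forall a b d, t a = s b -> t b = s d ->
    c (c a b) d = c a (c b d);
  law_id_comp : forall a, c (i (s a)) a = a;
  law_comp_id : forall a, c a (i (t a)) = a }.

(* [O], [A], [B] are the sets of [p]-, [q]- and [n]-arrows; [cB0] and [cB1] are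
   the compositions [#p] and [#q] of [n]-arrows, [cA] is [#p] on [q]-arrows. *)
Record two_category_laws (O A B : Type) (sA tA : A -> O) (sB tB : B -> A)
    (iB : A -> B) (cA : A -> A -> A) (cB0 cB1 : B -> B -> B) : Prop := {
  law_glob_src : forall b, sA (sB b) = sA (tB b);
  law_glob_tgt : forall b, tA (sB b) = tA (tB b);
  law_src_hcomp : forall b b', tA (sB b) = sA (sB b') ->
    sB (cB0 b b') = cA (sB b) (sB b');
  law_tgt_hcomp : forall b b', tA (sB b) = sA (sB b') ->
    tB (cB0 b b') = cA (tB b) (tB b');
  law_id_hcomp : forall a a', tA a = sA a' -> iB (cA a a') = cB0 (iB a) (iB a');
  law_interchange : forall a b a' b', tB a = sB b -> tB a' = sB b' ->
    tA (sB a) = sA (sB a') ->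
    cB0 (cB1 a b) (cB1 a' b') = cB1 (cB0 a a') (cB0 b b') }.

Record strict3cat := Strict3Cat {
  obj : Type;
  arr1 : Type;
  arr2 : Type;
  arr3 : Type;
  src1 : arr1 -> obj;
  tgt1 : arr1 -> obj;
  src2 : arr2 -> arr1;
  tgt2 : arr2 -> arr1;
  src3 : arr3 -> arr2;
  tgt3 : arr3 -> arr2;
  id1 : obj -> arr1;
  id2 : arr1 -> arr2;
  id3 : arr2 -> arr3;
  comp1_0 : arr1 -> arr1 -> arr1;
  comp2_0 : arr2 -> arr2 -> arr2;
  comp2_1 : arr2 -> arr2 -> arr2;
  comp3_0 : arr3 -> arr3 -> arr3;
  comp3_1 : arr3 -> arr3 -> arr3;
  comp3_2 : arr3 -> arr3 -> arr3;
  cat_01 : category_laws src1 tgt1 id1 comp1_0;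
  cat_02 : category_laws (src1 \o src2) (tgt1 \o tgt2) (id2 \o id1) comp2_0;
  cat_12 : category_laws src2 tgt2 id2 comp2_1;
  cat_03 : category_laws (src1 \o src2 \o src3) (tgt1 \o tgt2 \o tgt3)
             (id3 \o id2 \o id1) comp3_0;
  cat_13 : category_laws (src2 \o src3) (tgt2 \o tgt3) (id3 \o id2) comp3_1;
  cat_23 : category_laws src3 tgt3 id3 comp3_2;
  twocat_012 : two_category_laws src1 tgt1 src2 tgt2 id2 comp1_0
                 comp2_0 comp2_1;
  twocat_013 : two_category_laws src1 tgt1 (src2 \o src3) (tgt2 \o tgt3)
                 (id3 \o id2) comp1_0 comp3_0 comp3_1;
  twocat_023 : two_category_laws (src1 \o src2) (tgt1 \o tgt2) src3 tgt3 id3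
                 comp2_0 comp3_0 comp3_2;
  twocat_123 : two_category_laws src2 tgt2 src3 tgt3 id3
                 comp2_1 comp3_1 comp3_2 }.

Declare Scope arr1_scope.
Declare Scope arr2_scope.
Declare Scope arr3_scope.
Delimit Scope arr1_scope with a1.
Delimit Scope arr2_scope with a2.
Delimit Scope arr3_scope with a3.
Bind Scope arr1_scope with arr1.
Bind Scope arr2_scope with arr2.
Bind Scope arr3_scope with arr3.

Arguments comp1_0 {s} (_ _)%_a1.
Arguments comp2_0 {s} (_ _)%_a2.
Arguments comp2_1 {s} (_ _)%_a2.
Arguments comp3_0 {s} (_ _)%_a3.
Arguments comp3_1 {s} (_ _)%_a3.
Arguments comp3_2 {s} (_ _)%_a3.

(* Identities are coercions, so that whiskering with a lower-dimensional arrow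
   is composition with its identity, as usual. *)
Coercion id2 : arr1 >-> arr2.
Coercion id3 : arr2 >-> arr3.

Reserved Notation "a #0 b" (at level 43, left associativity).
Reserved Notation "a #1 b" (at level 45, left associativity).
Reserved Notation "a #2 b" (at level 47, left associativity).

Notation "a #0 b" := (comp1_0 a b) : arr1_scope.
Notation "a #0 b" := (comp2_0 a b) : arr2_scope.
Notation "a #1 b" := (comp2_1 a b) : arr2_scope.
Notation "a #0 b" := (comp3_0 a b) : arr3_scope.
Notation "a #1 b" := (comp3_1 a b) : arr3_scope.
Notation "a #2 b" := (comp3_2 a b) : arr3_scope.

Section Arrows.
Variable C : strict3cat.

Definition hom1 (x y : obj C) (A : arr1 C) : Prop := src1 A = x /\ tgt1 A = y.
Definition hom2 (A B : arr1 C) (a : arr2 C) : Prop := src2 a = A /\ tgt2 a = B.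
Definition hom3 (a b : arr2 C) (T : arr3 C) : Prop := src3 T = a /\ tgt3 T = b.

Definition inverse2 (a b : arr2 C) : Prop :=
  [/\ hom2 (tgt2 a) (src2 a) b, (a #1 b)%a2 = id2 (src2 a)
    & (b #1 a)%a2 = id2 (tgt2 a)].
Definition inverse3 (T U : arr3 C) : Prop :=
  [/\ hom3 (tgt3 T) (src3 T) U, (T #2 U)%a3 = id3 (src3 T)
    & (U #2 T)%a3 = id3 (tgt3 T)].

Definition iso2 (A B : arr1 C) (a : arr2 C) : Prop :=
  hom2 A B a /\ exists b, inverse2 a b.
Definition iso3 (a b : arr2 C) (T : arr3 C) : Prop :=
  hom3 a b T /\ exists U, inverse3 T U.

Definition iso1 (x y : obj C) (B : arr1 C) : Prop :=
  hom1 x y B /\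
  exists2 D : arr1 C, hom1 y x D &
    (exists a, iso2 (id1 y) (D #0 B)%a1 a) /\
    (exists b, iso2 (id1 x) (B #0 D)%a1 b).

(* The (unique) inverse of an invertible arrow, unspecified otherwise. *)
Definition inv2 (a : arr2 C) : arr2 C := epsilon (inhabits a) (inverse2 a).
Definition inv3 (T : arr3 C) : arr3 C := epsilon (inhabits T) (inverse3 T).

End Arrows.

Record threerep (G : groupType) (C : strict3cat) := ThreeRep {
  rep_obj : obj C;
  rho : G -> arr1 C;
  phi : G -> G -> arr2 C;
  Phi : G -> G -> G -> arr3 C;
  phi1 : arr2 C;
  rho_iso : forall g, iso1 rep_obj rep_obj (rho g);
  phi_iso : forall h g, iso2 (rho h #0 rho g)%a1 (rho (h * g)) (phi h g);
  Phi_iso : forall g3 g2 g1,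
    iso3 ((rho g3 #0 phi g2 g1) #1 phi g3 (g2 * g1))%a2
         ((phi g3 g2 #0 rho g1) #1 phi (g3 * g2) g1)%a2
         (Phi g3 g2 g1);
  phi1_iso : iso2 (rho 1) (id1 rep_obj) phi1;
  phi_1l : forall g, phi 1 g = (phi1 #0 rho g)%a2;
  phi_1r : forall g, phi g 1 = (rho g #0 phi1)%a2;
  Phi_cocycle : forall g4 g3 g2 g1,
    (((rho g4 #0 Phi g3 g2 g1) #1 phi g4 (g3 * g2 * g1))
     #2 ((rho g4 #0 phi g3 g2 #0 rho g1) #1 Phi g4 (g3 * g2) g1)
     #2 ((Phi g4 g3 g2 #0 rho g1) #1 phi (g4 * g3 * g2) g1))%a3
    = ((((rho g4 #0 rho g3) #0 phi g2 g1) #1 Phi g4 g3 (g2 * g1))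
       #2 ((phi g4 g3 #0 (rho g2 #0 rho g1)) #1 Phi (g4 * g3) g2 g1))%a3 }.

Definition strictly_unital (G : groupType) (C : strict3cat)
    (r : threerep G C) : Prop :=
  rho r 1 = id1 (rep_obj r) /\ phi1 r = id2 (id1 (rep_obj r)).

Record category := Category {
  Ob :> Type;
  Hom : Ob -> Ob -> Type;
  idm : forall a, Hom a a;
  comp : forall a b c, Hom b c -> Hom a b -> Hom a c;
  comp_idl : forall a b (m : Hom a b), comp (idm b) m = m;
  comp_idr : forall a b (m : Hom a b), comp m (idm a) = m;
  compA : forall a b c d (m : Hom c d) (n : Hom b c) (p : Hom a b),
    comp m (comp n p) = comp (comp m n) p }.
Arguments Hom {_} _ _.
Arguments idm {_} _.
Arguments comp {_ _ _ _} _ _.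

Record functor (V W : category) := Functor {
  fobj :> V -> W;
  fmap : forall a b, Hom a b -> Hom (fobj a) (fobj b);
  fmap_id : forall a, fmap (idm a) = idm (fobj a);
  fmap_comp : forall a b c (m : Hom b c) (n : Hom a b),
    fmap (comp m n) = comp (fmap m) (fmap n) }.
Arguments fmap {_ _} _ {_ _} _.

Program Definition fid (W : category) : functor W W :=
  {| fobj := fun w => w; fmap := fun _ _ m => m |}.

Program Definition fcomp (U V W : category) (F : functor V W)
    (F' : functor U V) : functor U W :=
  {| fobj := fun u => F (F' u); fmap := fun _ _ m => fmap F (fmap F' m) |}.
Next Obligation. by rewrite !fmap_id. Qed.
Next Obligation. by rewrite !fmap_comp. Qed.

Record nattrans (V W : category) (F F' : functor V W) := NatTrans {
  component :> forall a, Hom (F a) (F' a);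
  naturality : forall a b (m : Hom a b),
    comp (component b) (fmap F m) = comp (fmap F' m) (component a) }.

Definition is_iso (W : category) (a b : W) (m : Hom a b) : Prop :=
  exists n : Hom b a, comp n m = idm a /\ comp m n = idm b.

Definition is_natiso (V W : category) (F F' : functor V W)
    (eta : nattrans F F') : Prop := forall a, is_iso (eta a).

Definition is_equivalence (V W : category) (F : functor V W) : Prop :=
  exists F' : functor W V,
    (exists eta : nattrans (fid V) (fcomp F' F), is_natiso eta) /\
    (exists eps : nattrans (fcomp F F') (fid W), is_natiso eps).

(* Transport along an equality of targets; it is needed because
   [psi (k * (h * g)) w] and [psi (k * h * g) w] are equal but not convertible. *)
Definition cast_cod (W : category) (a b b' : W) (e : b = b') (m : Hom a b) :
    Hom a b' :=
  eq_rect b (fun c => Hom a c) m b' e.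

Record is_categorical_action (K : groupType) (W : category)
    (psi : K -> functor W W)
    (Gamma : forall h g, nattrans (fcomp (psi h) (psi g)) (psi (h * g))) :
    Prop := {
  action_equiv : forall g, is_equivalence (psi g);
  action_iso : forall h g, is_natiso (Gamma h g);
  action_assoc : forall k h g (w : W),
    comp (Gamma k (h * g) w) (fmap (psi k) (Gamma h g w)) =
    cast_cod (congr1 (fun j => psi j w) (esym (mulgA k h g)))
      (comp (Gamma (k * h) g w) (Gamma k h (psi g w)));
  action_unit : exists iota : nattrans (psi 1) (fid W),
    [/\ is_natiso iota,
        forall g (w : W),
          cast_cod (congr1 (fun j => psi j w) (mul1g g)) (Gamma 1 g w) =
          iota (psi g w)
      & forall g (w : W),
          cast_cod (congr1 (fun j => psi j w) (mulg1 g)) (Gamma g 1 w) =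
          fmap (psi g) (iota w)] }.

Section Centralizer.
Variables (G : groupType) (f : G).

Definition centralizer_pred : {pred G} := [pred g | g * f == f * g].

Lemma centralizer_group_closed : group_closed centralizer_pred.
Proof.
split=> [|g h]; rewrite !inE ?mul1g ?mulg1 // => /eqP gf /eqP hf.
have hVf : h^-1 * f = f * h^-1.
  by rewrite -[in RHS](mulKg h f) hf !mulgA mulgK.
by rewrite -mulgA hVf !mulgA gf.
Qed.

Record centralizer : Type := Centralizer {
  centralizer_val : G;
  _ : centralizer_val \in centralizer_pred }.
HB.instance Definition _ := [isSub for centralizer_val].
HB.instance Definition _ := [Choice of centralizer by <:].
HB.instance Definition _ :=
  SubChoice_isSubGroup.Build G centralizer_pred centralizer
    centralizer_group_closed.

End Centralizer.

Section Trace.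
Variables (C : strict3cat) (x : obj C) (A : arr1 C).

Definition tr_obj := {a : arr2 C | hom2 (id1 x) A a}.
Definition tr_hom (a b : tr_obj) :=
  {T : arr3 C | hom3 (proj1_sig a) (proj1_sig b) T}.

Lemma tr_hom_eq (a b : tr_obj) (T U : tr_hom a b) :
  proj1_sig T = proj1_sig U -> T = U.
Proof.
case: T U => [T pT] [U pU] /= eTU; subst U.
by rewrite (proof_irrelevance _ pT pU).
Qed.

Lemma tr_id_subproof (a : tr_obj) :
  hom3 (proj1_sig a) (proj1_sig a) (id3 (proj1_sig a)).
Proof.
by split; [exact: (law_src_id (cat_23 C)) | exact: (law_tgt_id (cat_23 C))].
Qed.

Definition tr_id (a : tr_obj) : tr_hom a a := exist _ _ (tr_id_subproof a).

Lemma tr_comp_subproof (a b c : tr_obj) (U : tr_hom b c) (T : tr_hom a b) :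
  hom3 (proj1_sig a) (proj1_sig c) (proj1_sig T #2 proj1_sig U)%a3.
Proof.
case: T U => [T [sT tT]] [U [sU tU]] /=; have TU : tgt3 T = src3 U by rewrite tT.
by split; [rewrite (law_src_comp (cat_23 C)) | rewrite (law_tgt_comp (cat_23 C))].
Qed.

Definition tr_comp (a b c : tr_obj) (U : tr_hom b c) (T : tr_hom a b) :
  tr_hom a c := exist _ _ (tr_comp_subproof U T).

Program Definition Tr2 : category :=
  {| Ob := tr_obj; Hom := tr_hom; idm := tr_id; comp := tr_comp |}.
Next Obligation.
apply: tr_hom_eq; case: m => [T [sT tT]]; rewrite /= -tT.
exact: (law_comp_id (cat_23 C)).
Qed.
Next Obligation.
apply: tr_hom_eq; case: m => [T [sT tT]]; rewrite /= -sT.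
exact: (law_id_comp (cat_23 C)).
Qed.
Next Obligation.
apply: tr_hom_eq; case: m n p => [T [sT tT]] [U [sU tU]] [V [sV tV]] /=.
by apply: (law_assoc (cat_23 C)); [rewrite tV | rewrite tU].
Qed.

End Trace.

Section Action.
Variables (G : groupType) (C : strict3cat) (r : threerep G C) (f : G).
Notation "'ρ' g" := (rho r g) (at level 9, g at level 8).
Notation "'φ'" := (phi r).
Notation "'Φ'" := (Phi r).

Definition unit_cell (g : G) : arr2 C := inv2 (φ g g^-1).

Definition psi_arr2 (g : G) (w : arr2 C) : arr2 C :=
  (unit_cell g #1 (ρ g #0 w #0 ρ g^-1) #1 (φ g f #0 ρ g^-1)
   #1 φ (g * f) g^-1)%a2.

Definition psi_arr3 (g : G) (w : arr3 C) : arr3 C :=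
  (unit_cell g #1 (ρ g #0 w #0 ρ g^-1) #1 (φ g f #0 ρ g^-1)
   #1 φ (g * f) g^-1)%a3.

Section Lambda.
Variables (h g e : G).

Definition Lcell : arr2 C :=
  ((ρ h #0 φ g e #0 (ρ g^-1 #0 ρ h^-1))
   #1 (ρ h #0 φ (g * e) g^-1 #0 ρ h^-1)
   #1 (φ h (g * e * g^-1) #0 ρ h^-1)
   #1 φ (h * g * e * g^-1) h^-1)%a2.

Definition Rcell : arr2 C :=
  ((φ h g #0 (ρ e #0 ρ g^-1 #0 ρ h^-1))
   #1 (φ (h * g) e #0 (ρ g^-1 #0 ρ h^-1))
   #1 (ρ (h * g * e) #0 φ g^-1 h^-1)
   #1 φ (h * g * e) (g^-1 * h^-1))%a2.

Definition Lambda1 : arr3 C :=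
  ((ρ h #0 φ g e #0 (ρ g^-1 #0 ρ h^-1))
   #1 (Φ h (g * e) g^-1 #0 ρ h^-1)
   #1 φ (h * g * e * g^-1) h^-1)%a3.

Definition Lambda2 : arr3 C :=
  ((Φ h g e #0 (ρ g^-1 #0 ρ h^-1))
   #1 (φ (h * g * e) g^-1 #0 ρ h^-1)
   #1 φ (h * g * e * g^-1) h^-1)%a3.

Definition Lambda3 : arr3 C :=
  ((φ h g #0 (ρ e #0 ρ g^-1 #0 ρ h^-1))
   #1 (φ (h * g) e #0 (ρ g^-1 #0 ρ h^-1))
   #1 inv3 (Φ (h * g * e) g^-1 h^-1))%a3.

Definition Lambda : arr3 C := (Lambda1 #2 Lambda2 #2 Lambda3)%a3.

Definition Lambda_adj : arr3 C :=
  (inv2 Lcell #1 inv3 Lambda #1 inv2 Rcell)%a3.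

End Lambda.

Definition Gamma_arr3 (h g : G) (w : arr2 C) : arr3 C :=
  (Lambda_adj h g 1 #1 ((ρ h #0 ρ g) #0 w #0 (ρ g^-1 #0 ρ h^-1))
   #1 Lambda h g f)%a3.

End Action.

Notation Tr2_rho r f := (Tr2 (rep_obj r) (rho r f)).

(* Main.v *)
Require Import Defs.
From mathcomp Require Import all_boot.
From Stdlib Require Import Classical ClassicalEpsilon.

(** Fix the object [x].  The 2-arrows [A => rho a] out of endomorphisms [A] of
    [x], graded by [a], form a category under [#2], and
    [(u, v) |-> (u #0 v) #1 phi a b] is a tensor product on it.  Whiskering
    [Phi] gives the associator, and the 3-cocycle condition is exactly
    Mac Lane's pentagon ([pentagon]).  In this language, with [g] also standing
    for the identity 2-arrow of [rho g], the functor [psi_g] is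
    [w |-> (g w) g^-1] precomposed with [u_g], and [Lambda_{h,g}] is the
    composite of three associators
    [(h((g w)g^-1))h^-1 -> ((h g)w)(g^-1 h^-1)].

    The associativity of [Gamma] rests on a coherence law valid in every
    category with an associative tensor product ([conj_compA]): rewriting three
    nested conjugations in the two possible orders gives the same result, up to
    the associators of [k, h, g] and of [g^-1, h^-1, k^-1].  It uses the
    pentagon four times.

    Both [psi_g] and [Gamma_{h,g}] have a left factor, [u_g] or the adjoint of
    [Lambda^1].  That factor is a two-sided inverse for [#1] of the same
    expression evaluated at the unit cell [1 => rho 1] (for the adjoint this
    is [hinv_adjoint]).  So [psi_g] and [Gamma_{h,g}] are quotients
    [S^-1 #1 T], where [T] is a natural construction applied to an arrow of the
    trace and [S] is the same construction applied to the unit cell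
    ([lquot_conj], [lquot_Lambda]).  Such quotients are unique and are
    multiplicative for [#2] ([lquot_uniq], [lquot_comp2]).  Hence every law
    natural in the middle cell passes to the quotients: the boundaries of
    [Gamma], its naturality and invertibility, and its associativity, where the
    extra associators of [conj_compA] contribute an identity quotient.

    The functor [psi_1] is the identity, and [iota] is [Gamma_{1,1}].  The two
    unit laws follow from associativity at [k = h = 1] and at [h = g = 1] by
    cancelling an invertible 3-arrow, even though the components of [Phi] with
    a unit index may be nontrivial.  Finally [psi_{g^-1}] is inverse to [psi_g]
    up to isomorphism, by [Gamma] and [iota]. *)

Set Implicit Arguments.
Unset Strict Implicit.
Unset Printing Implicit Defensive.

Local Open Scope group_scope.

(** * Coherence for nested conjugations *)

Section Semigroupal.
Variables (W : category) (ten : W -> W -> W)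
  (hten : forall a a' b b', Hom a a' -> Hom b b' -> Hom (ten a b) (ten a' b'))
  (asc : forall a b c, Hom (ten a (ten b c)) (ten (ten a b) c))
  (ascV : forall a b c, Hom (ten (ten a b) c) (ten a (ten b c))).

Local Notation "a ⊗ b" := (ten a b) (at level 40, left associativity).
Local Notation "S ⊠ T" := (hten S T) (at level 40, left associativity).
Local Notation "S ;; T" := (Defs.comp T S) (at level 50, left associativity).
Local Notation "1[ a ]" := (@idm W a).

Hypothesis ten_id : forall a b, 1[a] ⊠ 1[b] = 1[a ⊗ b].
Hypothesis ten_comp : forall a a' a'' b b' b'' (S : Hom a a') (S' : Hom a' a'')
  (T : Hom b b') (T' : Hom b' b''), (S ;; S') ⊠ (T ;; T') = S ⊠ T ;; S' ⊠ T'.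
Hypothesis ascK : forall a b c, asc a b c ;; ascV a b c = 1[_].
Hypothesis ascVK : forall a b c, ascV a b c ;; asc a b c = 1[_].
Hypothesis asc_nat : forall a a' b b' c c' (S : Hom a a') (T : Hom b b')
  (U : Hom c c'), S ⊠ (T ⊠ U) ;; asc a' b' c' = asc a b c ;; S ⊠ T ⊠ U.
Hypothesis pentagon : forall a b c d,
  1[a] ⊠ asc b c d ;; asc a (b ⊗ c) d ;; asc a b c ⊠ 1[d]
  = asc a b (c ⊗ d) ;; asc (a ⊗ b) c d.

(** Composes the conjugations by [h] and [g].  The cells [g'] and [h'] stand for
    the inverses of [g] and [h], but the coherence needs no relation between
    them, so they are arbitrary. *)
Definition conj_comp h g w g' h' :
    Hom (h ⊗ (g ⊗ w ⊗ g') ⊗ h') (h ⊗ g ⊗ w ⊗ (g' ⊗ h')) :=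
  asc h (g ⊗ w) g' ⊠ 1[h'] ;; asc h g w ⊠ 1[g'] ⊠ 1[h'] ;; ascV (h ⊗ g ⊗ w) g' h'.

Let idl (a b : W) (S : Hom a b) : 1[a] ;; S = S. Proof. exact: comp_idr. Qed.
Let idr (a b : W) (S : Hom a b) : S ;; 1[b] = S. Proof. exact: comp_idl. Qed.
Let cA (a b c d : W) (S : Hom a b) (T : Hom b c) (U : Hom c d) :
  S ;; (T ;; U) = S ;; T ;; U.
Proof. by rewrite Defs.compA. Qed.

Lemma ten_idl_comp (a b c d : W) (S : Hom a b) (T : Hom b c) :
  1[d] ⊠ (S ;; T) = 1[d] ⊠ S ;; 1[d] ⊠ T.
Proof. by rewrite -ten_comp idl. Qed.
Lemma ten_idr_comp (a b c d : W) (S : Hom a b) (T : Hom b c) :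
  (S ;; T) ⊠ 1[d] = S ⊠ 1[d] ;; T ⊠ 1[d].
Proof. by rewrite -ten_comp idl. Qed.

Lemma ascV_nat a a' b b' c c' (S : Hom a a') (T : Hom b b') (U : Hom c c') :
  S ⊠ T ⊠ U ;; ascV a' b' c' = ascV a b c ;; S ⊠ (T ⊠ U).
Proof.
rewrite -[LHS]idl -(ascVK a b c) cA -(cA (ascV _ _ _) (asc _ _ _)) -asc_nat.
by rewrite -!cA ascK idr.
Qed.

Lemma post_iso_inj (a b c : W) (S : Hom b c) (S' : Hom c b) (T U : Hom a b) :
  S ;; S' = 1[b] -> T ;; S = U ;; S -> T = U.
Proof. by move=> SK e; rewrite -[T]idr -[U]idr -SK !cA e. Qed.
Lemma pre_iso_inj (a b c : W) (S : Hom a b) (S' : Hom b a) (T U : Hom b c) :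
  S' ;; S = 1[b] -> S ;; T = S ;; U -> T = U.
Proof. by move=> SK e; rewrite -[T]idl -[U]idl -SK -!cA e. Qed.

Lemma iso_ten a a' b b' (S : Hom a a') (T : Hom b b') :
  is_iso S -> is_iso T -> is_iso (S ⊠ T).
Proof.
move=> [S' [SK KS]] [T' [TK KT]]; exists (S' ⊠ T').
by rewrite -!ten_comp SK KS TK KT !ten_id.
Qed.
Lemma iso_comp (a b c : W) (S : Hom a b) (T : Hom b c) :
  is_iso S -> is_iso T -> is_iso (S ;; T).
Proof.
move=> [S' [SK KS]] [T' [TK KT]]; exists (T' ;; S'); split.
  by rewrite cA -(cA S T) TK idr SK.
by rewrite cA -(cA T' S') KS idr KT.
Qed.
Lemma iso_id (a : W) : is_iso 1[a].
Proof. by exists 1[a]; rewrite idl. Qed.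
Lemma iso_asc a b c : is_iso (asc a b c).
Proof. by exists (ascV a b c). Qed.
Lemma iso_ascV a b c : is_iso (ascV a b c).
Proof. by exists (asc a b c). Qed.

Lemma iso_conj_comp h g w g' h' : is_iso (conj_comp h g w g' h').
Proof.
by do 2?[apply: iso_comp]; do 2?[apply: iso_ten];
  first [exact: iso_id | exact: iso_asc | exact: iso_ascV].
Qed.

Lemma conj_comp_nat h g g' h' w w' (S : Hom w w') :
  (1[h] ⊠ (1[g] ⊠ S ⊠ 1[g'])) ⊠ 1[h'] ;; conj_comp h g w' g' h'
  = conj_comp h g w g' h' ;; (1[h ⊗ g] ⊠ S) ⊠ 1[g' ⊗ h'].
Proof.
rewrite /conj_comp -(ten_id g' h') -[RHS]cA -ascV_nat !cA; congr (_ ;; _).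
rewrite -!ten_idr_comp; congr (_ ⊠ _).
rewrite asc_nat -!cA; congr (_ ;; _).
by rewrite -!ten_idr_comp -ten_id asc_nat.
Qed.

(** Each side is inverse to one side of [pentagon]. *)
Lemma pentagonV a b c d :
  ascV (a ⊗ b) c d ;; ascV a b (c ⊗ d)
  = ascV a b c ⊠ 1[d] ;; ascV a (b ⊗ c) d ;; 1[a] ⊠ ascV b c d.
Proof.
apply: (post_iso_inj (S := asc a b (c ⊗ d)) (S' := ascV _ _ _)); first exact: ascK.
rewrite -[LHS]cA ascVK idr.
apply: (post_iso_inj (S := asc (a ⊗ b) c d) (S' := ascV _ _ _)); first exact: ascK.
rewrite ascVK -(cA _ (asc a b _)) -pentagon !cA.
rewrite -(cA _ (1[a] ⊠ ascV _ _ _)) -ten_idl_comp ascVK ten_id idr.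
rewrite -(cA _ (ascV _ _ _)) ascVK idr -ten_idr_comp ascVK.
by rewrite ten_id.
Qed.

(** There are three kinds of moves: reassociating the left factors [k, h, g],
    reassociating the right ones, and moving a left factor past a right one.
    The left moves satisfy one pentagon among themselves and so do the right
    moves; two more pentagons (in [inner] and [move_k]) say that moving past a
    factor commutes with reassociation on either side. *)
Lemma conj_compA k h g w g' h' k' :
  1[k] ⊠ conj_comp h g w g' h' ⊠ 1[k'] ;; conj_comp k (h ⊗ g) w (g' ⊗ h') k'
  ;; asc k h g ⊠ 1[w] ⊠ ascV g' h' k'
  = conj_comp k h (g ⊗ w ⊗ g') h' k' ;; conj_comp (k ⊗ h) g w g' (h' ⊗ k').
Proof.
have move_k s : 1[k] ⊠ ascV s g' h' ;; asc k s (g' ⊗ h')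
    = asc k (s ⊗ g') h' ;; asc k s g' ⊠ 1[h'] ;; ascV (k ⊗ s) g' h'.
  apply: (pre_iso_inj (S := 1[k] ⊠ asc s g' h') (S' := 1[k] ⊠ ascV s g' h')).
    by rewrite -ten_idl_comp ascVK ten_id.
  apply: (post_iso_inj (S := asc (k ⊗ s) g' h') (S' := ascV _ _ _)).
    exact: ascK.
  rewrite !cA -[1[k] ⊠ _ ;; 1[k] ⊠ _]ten_idl_comp ascK ten_id idl.
  by rewrite -(cA _ (ascV _ _ _)) ascVK idr pentagon.
set s := k ⊗ h ⊗ g ⊗ w.
(* The left factors [k, h, g] and the right factor [g'] only. *)
have inner : 1[k] ⊠ asc h (g ⊗ w) g' ;; 1[k] ⊠ (asc h g w ⊠ 1[g'])
    ;; asc k (h ⊗ g ⊗ w) g' ;; asc k (h ⊗ g) w ⊠ 1[g']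
    ;; asc k h g ⊠ 1[w] ⊠ 1[g']
  = asc k h (g ⊗ w ⊗ g') ;; asc (k ⊗ h) (g ⊗ w) g' ;; asc (k ⊗ h) g w ⊠ 1[g'].
  rewrite -(cA _ _ (asc k _ g')) asc_nat -pentagon -!cA.
  do 2!congr (_ ;; _).
  by rewrite -!ten_idr_comp -pentagon !cA.
(* The right factor [h'] is added; [ascV] is pushed to the end. *)
have middle : 1[k] ⊠ conj_comp h g w g' h' ;; asc k (h ⊗ g ⊗ w) (g' ⊗ h')
    ;; asc k (h ⊗ g) w ⊠ 1[_] ;; asc k h g ⊠ 1[w] ⊠ 1[_]
  = asc k (h ⊗ (g ⊗ w ⊗ g')) h' ;; (asc k h (g ⊗ w ⊗ g')
    ;; asc (k ⊗ h) (g ⊗ w) g' ;; asc (k ⊗ h) g w ⊠ 1[g']) ⊠ 1[h']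
    ;; ascV s g' h'.
  rewrite /conj_comp 2!ten_idl_comp -!cA (cA (_ ⊠ ascV _ _ _)) move_k.
  rewrite -(ten_idr_comp (g' ⊗ h')) -(ten_id g' h') -!cA -(ascV_nat _ 1[g'] 1[h']).
  rewrite !cA -inner !ten_idr_comp !cA; do 4!congr (_ ;; _).
  by rewrite -cA asc_nat cA asc_nat.
(* On the right-hand side, the two [ascV] are collected at the end, where
   [pentagonV] applies to them. *)
transitivity ((asc k (h ⊗ (g ⊗ w ⊗ g')) h' ;; (asc k h (g ⊗ w ⊗ g')
    ;; asc (k ⊗ h) (g ⊗ w) g' ;; asc (k ⊗ h) g w ⊠ 1[g']) ⊠ 1[h']) ⊠ 1[k']
    ;; ascV (s ⊗ g') h' k' ;; ascV s g' (h' ⊗ k')); last first.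
  rewrite /conj_comp !ten_idr_comp !cA; congr (_ ;; _).
  rewrite -!cA; do 2!congr (_ ;; _).
  rewrite !cA -(ten_id h' k') -ascV_nat -!cA; congr (_ ;; _).
  by rewrite -ascV_nat.
rewrite -[RHS]cA pentagonV !cA -!(ten_idr_comp k') -middle !ten_idr_comp -!cA.
do 3!congr (_ ;; _).
by rewrite [RHS]cA ascV_nat -cA -ten_comp idr ten_id idl.
Qed.
End Semigroupal.

(** * Three-arrows around an object *)

Section ThreeCells.
Variables (C : strict3cat) (x : obj C).
Implicit Types (A B : arr1 C) (a b : arr2 C) (S T U : arr3 C).
Local Open Scope arr3_scope.

(** A 2-arrow is handled as its identity 3-arrow: [id3] is injective and
    respects all compositions, so one calculus on 3-arrows covers both
    dimensions. *)
Definition dom1 T := src2 (src3 T).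
Definition cod1 T := tgt2 (src3 T).

Lemma src2_id A : src2 (id2 A) = A. Proof. exact: law_src_id (cat_12 C) A. Qed.
Lemma tgt2_id A : tgt2 (id2 A) = A. Proof. exact: law_tgt_id (cat_12 C) A. Qed.
Lemma src3_id a : src3 (id3 a) = a. Proof. exact: law_src_id (cat_23 C) a. Qed.
Lemma tgt3_id a : tgt3 (id3 a) = a. Proof. exact: law_tgt_id (cat_23 C) a. Qed.
Lemma id3_inj : injective (@id3 C). Proof. exact: can_inj src3_id. Qed.

Lemma dom1_id a : dom1 (id3 a) = src2 a. Proof. by rewrite /dom1 src3_id. Qed.
Lemma cod1_id a : cod1 (id3 a) = tgt2 a. Proof. by rewrite /cod1 src3_id. Qed.
Lemma dom1_tgt3 T : src2 (tgt3 T) = dom1 T.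
Proof. by rewrite -(law_glob_src (twocat_123 C)). Qed.
Lemma cod1_tgt3 T : tgt2 (tgt3 T) = cod1 T.
Proof. by rewrite -(law_glob_tgt (twocat_123 C)). Qed.

Lemma src3_comp1 S T : cod1 S = dom1 T -> src3 (S #1 T) = (src3 S #1 src3 T)%a2.
Proof. exact: law_src_hcomp (twocat_123 C) S T. Qed.
Lemma tgt3_comp1 S T : cod1 S = dom1 T -> tgt3 (S #1 T) = (tgt3 S #1 tgt3 T)%a2.
Proof. exact: law_tgt_hcomp (twocat_123 C) S T. Qed.
Lemma dom1_comp1 S T : cod1 S = dom1 T -> dom1 (S #1 T) = dom1 S.
Proof. by move=> st; rewrite /dom1 src3_comp1 // (law_src_comp (cat_12 C)). Qed.
Lemma cod1_comp1 S T : cod1 S = dom1 T -> cod1 (S #1 T) = cod1 T.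
Proof. by move=> st; rewrite /cod1 src3_comp1 // (law_tgt_comp (cat_12 C)). Qed.
Lemma comp1A S T U : cod1 S = dom1 T -> cod1 T = dom1 U ->
  S #1 T #1 U = S #1 (T #1 U).
Proof.
by move=> st tu; apply: (law_assoc (cat_13 C)); rewrite /= (cod1_tgt3, st) // cod1_tgt3.
Qed.
Lemma id_comp1 A T : dom1 T = A -> A #1 T = T.
Proof. by move<-; exact: law_id_comp (cat_13 C) T. Qed.
Lemma comp1_id A T : cod1 T = A -> T #1 A = T.
Proof.
by move<-; rewrite -cod1_tgt3; exact: law_comp_id (cat_13 C) T.
Qed.
Lemma id3_comp1 a b : tgt2 a = src2 b -> id3 (a #1 b)%a2 = a #1 b.
Proof. exact: law_id_hcomp (twocat_123 C) a b. Qed.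

Lemma src3_comp2 S T : tgt3 S = src3 T -> src3 (S #2 T) = src3 S.
Proof. exact: law_src_comp (cat_23 C) S T. Qed.
Lemma tgt3_comp2 S T : tgt3 S = src3 T -> tgt3 (S #2 T) = tgt3 T.
Proof. exact: law_tgt_comp (cat_23 C) S T. Qed.
Lemma dom1_comp2 S T : tgt3 S = src3 T -> dom1 (S #2 T) = dom1 S.
Proof. by move=> st; rewrite /dom1 src3_comp2. Qed.
Lemma cod1_comp2 S T : tgt3 S = src3 T -> cod1 (S #2 T) = cod1 S.
Proof. by move=> st; rewrite /cod1 src3_comp2. Qed.
Lemma comp2A S T U : tgt3 S = src3 T -> tgt3 T = src3 U ->
  S #2 T #2 U = S #2 (T #2 U).
Proof. exact: law_assoc (cat_23 C) S T U. Qed.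
Lemma id_comp2 a T : src3 T = a -> a #2 T = T.
Proof. by move<-; exact: law_id_comp (cat_23 C) T. Qed.
Lemma comp2_id a T : tgt3 T = a -> T #2 a = T.
Proof. by move<-; exact: law_comp_id (cat_23 C) T. Qed.
Lemma interchange12 S S' T T' : tgt3 S = src3 S' -> tgt3 T = src3 T' ->
  cod1 S = dom1 T -> (S #2 S') #1 (T #2 T') = (S #1 T) #2 (S' #1 T').
Proof. exact: law_interchange (twocat_123 C) S S' T T'. Qed.

(** All arrows met below lie over the single object [x], so that [#0] is always
    defined and its side conditions reduce to membership in [endo]. *)
Definition endo1 A := hom1 x x A.
Definition endo T := endo1 (dom1 T).

Lemma endo1_cod T : endo T -> endo1 (cod1 T).
Proof.
case=> sx tx; split; rewrite /cod1.
  by rewrite -(law_glob_src (twocat_012 C)).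
by rewrite -(law_glob_tgt (twocat_012 C)).
Qed.
Lemma endo1_comp A B : endo1 A -> endo1 B -> endo1 (A #0 B)%a1.
Proof.
case=> sA tA [sB tB]; split.
  by rewrite (law_src_comp (cat_01 C)) // tA.
by rewrite (law_tgt_comp (cat_01 C)) // tA.
Qed.
Lemma endo1_comp0A A B D : endo1 A -> endo1 B -> endo1 D ->
  (A #0 B #0 D = A #0 (B #0 D))%a1.
Proof.
by case=> sA tA [sB tB] [sD tD]; apply: (law_assoc (cat_01 C)); rewrite ?tA ?tB.
Qed.
Lemma endo1_comp0_id A : endo1 A -> (A #0 id1 x)%a1 = A.
Proof. by case=> _ <-; exact: law_comp_id (cat_01 C) A. Qed.
Lemma endo1_id_comp0 A : endo1 A -> (id1 x #0 A)%a1 = A.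
Proof. by case=> <- _; exact: law_id_comp (cat_01 C) A. Qed.
Let glue1 S T : endo S -> endo T -> tgt1 (dom1 S) = src1 (dom1 T).
Proof. by move=> [_ ->] [->]. Qed.
Let glue2 S T : endo S -> endo T -> tgt1 (cod1 S) = src1 (dom1 T).
Proof. by move=> /endo1_cod[_ ->] [->]. Qed.
Lemma src3_comp0 S T : endo S -> endo T -> src3 (S #0 T) = (src3 S #0 src3 T)%a2.
Proof. by move=> eS eT; apply: (law_src_hcomp (twocat_023 C)); exact: glue2. Qed.
Lemma tgt3_comp0 S T : endo S -> endo T -> tgt3 (S #0 T) = (tgt3 S #0 tgt3 T)%a2.
Proof. by move=> eS eT; apply: (law_tgt_hcomp (twocat_023 C)); exact: glue2. Qed.
Lemma dom1_comp0 S T : endo S -> endo T -> dom1 (S #0 T) = (dom1 S #0 dom1 T)%a1.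
Proof. by move=> eS eT; apply: (law_src_hcomp (twocat_013 C)); exact: glue1. Qed.
Lemma cod1_comp0 S T : endo S -> endo T -> cod1 (S #0 T) = (cod1 S #0 cod1 T)%a1.
Proof.
move=> eS eT; rewrite -!cod1_tgt3.
by apply: (law_tgt_hcomp (twocat_013 C)); exact: glue1.
Qed.
Lemma endo_comp0 S T : endo S -> endo T -> endo (S #0 T).
Proof. by move=> eS eT; rewrite /endo dom1_comp0 //; exact: endo1_comp. Qed.
Lemma comp0A S T U : endo S -> endo T -> endo U -> S #0 T #0 U = S #0 (T #0 U).
Proof.
move=> eS eT eU; apply: (law_assoc (cat_03 C)); rewrite /= -/(cod1 _).
  by rewrite cod1_tgt3; exact: glue2.
by rewrite cod1_tgt3; exact: glue2.
Qed.
Lemma id_comp0 T : endo T -> id1 x #0 T = T.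
Proof. by case=> <- _; exact: law_id_comp (cat_03 C) T. Qed.
Lemma comp0_id T : endo T -> T #0 id1 x = T.
Proof.
move=> /endo1_cod; rewrite -cod1_tgt3 => -[_ <-].
exact: law_comp_id (cat_03 C) T.
Qed.
Lemma id3_comp0 a b : endo a -> endo b -> id3 (a #0 b)%a2 = a #0 b.
Proof.
move=> ea eb; apply: (law_id_hcomp (twocat_023 C)) => /=.
by rewrite -cod1_id -dom1_id; exact: glue2.
Qed.
Lemma id23_comp0 A B : endo1 A -> endo1 B -> id3 (id2 (A #0 B)%a1) = A #0 B.
Proof.
by move=> [_ tA] [sB _]; apply: (law_id_hcomp (twocat_013 C)); rewrite tA.
Qed.
Lemma interchange02 S S' T T' : tgt3 S = src3 S' -> tgt3 T = src3 T' ->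
  endo S -> endo T -> (S #2 S') #0 (T #2 T') = (S #0 T) #2 (S' #0 T').
Proof.
move=> st st' eS eT; apply: (law_interchange (twocat_023 C)) => //.
exact: glue2.
Qed.
Lemma interchange01 S S' T T' : cod1 S = dom1 S' -> cod1 T = dom1 T' ->
  endo S -> endo T -> (S #1 S') #0 (T #1 T') = (S #0 T) #1 (S' #0 T').
Proof.
move=> st st' eS eT; apply: (law_interchange (twocat_013 C)).
- by rewrite /= -/(cod1 _) cod1_tgt3.
- by rewrite /= -/(cod1 _) cod1_tgt3.
exact: glue1.
Qed.

Lemma endo_comp1 S T : cod1 S = dom1 T -> endo S -> endo (S #1 T).
Proof. by move=> st; rewrite /endo dom1_comp1. Qed.
Lemma dom1_id2 A : dom1 (id3 (id2 A)) = A.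
Proof. by rewrite dom1_id src2_id. Qed.
Lemma cod1_id2 A : cod1 (id3 (id2 A)) = A.
Proof. by rewrite cod1_id tgt2_id. Qed.
Lemma endo_id2 A : endo1 A -> endo (id3 (id2 A)).
Proof. by rewrite /endo dom1_id2. Qed.
Lemma endo1_id : endo1 (id1 x).
Proof.
by split; [exact: law_src_id (cat_01 C) x | exact: law_tgt_id (cat_01 C) x].
Qed.

Lemma src3_comp1_id a T : tgt2 a = dom1 T -> src3 (a #1 T) = (a #1 src3 T)%a2.
Proof. by move=> aT; rewrite src3_comp1 ?cod1_id // src3_id. Qed.

(** Inverse for [#1], at the level of 3-arrows; on identities it is [inverse2]. *)
Definition hinv S S' := [/\ cod1 S = dom1 S', cod1 S' = dom1 S,
  S #1 S' = id2 (dom1 S) & S' #1 S = id2 (cod1 S)].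

Lemma hinv_uniq S T T' : hinv S T -> hinv S T' -> T = T'.
Proof.
move=> [st ts e1 e2] [st' ts' e1' e2'].
rewrite -[T](@comp1_id (dom1 S)) // -e1' -comp1A // e2.
by rewrite id_comp1.
Qed.

Lemma hinv_comp1 S S' T T' : cod1 S = dom1 T -> hinv S S' -> hinv T T' ->
  hinv (S #1 T) (T' #1 S').
Proof.
move=> st [ss' s's e1 e1'] [tt' t't e2 e2'].
have t's' : cod1 T' = dom1 S' by rewrite t't -st.
split; rewrite ?dom1_comp1 ?cod1_comp1 //.
  rewrite comp1A ?dom1_comp1 // -[T #1 _]comp1A // e2.
  by rewrite id_comp1 ?e1 // -ss'.
rewrite comp1A ?dom1_comp1 // -[S' #1 _]comp1A // e1'.
by rewrite id_comp1 ?e2' // -st.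
Qed.

Lemma hinv_comp0 S S' T T' : endo S -> endo T -> hinv S S' -> hinv T T' ->
  hinv (S #0 T) (S' #0 T').
Proof.
move=> eS eT [ss' s's e1 e1'] [tt' t't e2 e2'].
have eS' : endo S' by rewrite /endo -ss'; exact: endo1_cod.
have eT' : endo T' by rewrite /endo -tt'; exact: endo1_cod.
split; rewrite ?dom1_comp0 ?cod1_comp0 ?ss' ?tt' ?s's ?t't //.
  by rewrite -interchange01 // e1 e2 -id23_comp0.
by rewrite -interchange01 // e1' e2' ss' tt' -id23_comp0.
Qed.

Lemma inverse2_uniq a b b' : inverse2 a b -> inverse2 a b' -> b = b'.
Proof.
move=> [[sb tb] ab ba] [[sb' tb'] ab' ba'].
rewrite -[b](law_comp_id (cat_12 C)) tb -ab' -(law_assoc (cat_12 C)) ?sb' //.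
by rewrite ba -sb' (law_id_comp (cat_12 C)).
Qed.

Lemma inverse3_uniq T U U' : inverse3 T U -> inverse3 T U' -> U = U'.
Proof.
move=> [[sb tb] ab ba] [[sb' tb'] ab' ba'].
by rewrite -[U](@comp2_id (src3 T)) // -ab' -comp2A ?sb' // ba id_comp2.
Qed.

Lemma inv2_eq a b : inverse2 a b -> inv2 a = b.
Proof.
move=> ab; apply: (@inverse2_uniq a) => //.
by apply: epsilon_spec; exists b.
Qed.

Lemma inv3_eq T U : inverse3 T U -> inv3 T = U.
Proof.
move=> TU; apply: (@inverse3_uniq T) => //.
by apply: epsilon_spec; exists U.
Qed.

Lemma hinv_id a b : inverse2 a b -> hinv (id3 a) (id3 b).
Proof.
move=> [[sb tb] ab ba]; split; rewrite ?dom1_id ?cod1_id //.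
  by rewrite -id3_comp1 // ab.
by rewrite -id3_comp1 // ba.
Qed.

Lemma hinv_src3 S S' : hinv S S' -> inverse2 (src3 S) (src3 S').
Proof.
move=> [ss' s's e e']; split => //.
  by rewrite -src3_comp1 // e src3_id.
by rewrite -src3_comp1 // e' src3_id.
Qed.

Lemma hinv_tgt3 S S' : hinv S S' -> inverse2 (tgt3 S) (tgt3 S').
Proof.
move=> [ss' s's e e']; split => //.
- by rewrite /hom2 !(dom1_tgt3, cod1_tgt3).
- by rewrite -tgt3_comp1 // e tgt3_id dom1_tgt3.
by rewrite -tgt3_comp1 // e' tgt3_id cod1_tgt3.
Qed.

(** The common boundary of [S] and [T] has only one inverse 2-arrow. *)
Lemma hinv_comp2_glue S S' T T' : tgt3 S = src3 T -> hinv S S' -> hinv T T' ->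
  tgt3 S' = src3 T'.
Proof.
move=> st hS hT; apply: inverse2_uniq (hinv_tgt3 hS) _.
by rewrite st; exact: hinv_src3.
Qed.

Lemma hinv_comp2 S S' T T' : tgt3 S = src3 T -> hinv S S' -> hinv T T' ->
  hinv (S #2 T) (S' #2 T').
Proof.
move=> st hS hT; have st' := hinv_comp2_glue st hS hT.
case: hS hT => [ss' s's e1 e1'] [tt' t't e2 e2'].
have dT : dom1 T = dom1 S by rewrite /dom1 -st dom1_tgt3.
have cT : cod1 T = cod1 S by rewrite /cod1 -st cod1_tgt3.
split; rewrite ?dom1_comp2 ?cod1_comp2 // interchange12 //.
  by rewrite e1 e2 dT id_comp2 // src3_id.
by rewrite e1' e2' cT id_comp2 // src3_id.
Qed.

(** An invertible 3-arrow between invertible 2-arrows is invertible for [#1]: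
    the adjoint of its [#2]-inverse cancels it by interchange, since
    [T' #2 T] and [T #2 T'] are identities. *)
Lemma hinv_adjoint T T' a' b' : inverse3 T T' -> inverse2 (src3 T) a' ->
  inverse2 (tgt3 T) b' -> hinv T (a' #1 T' #1 b').
Proof.
move=> [[sT' tT'] TK KT] ha hb.
have [[sa' ta'] aK Ka] := ha; have [[sb' tb'] bK Kb] := hb.
have dT : dom1 T' = dom1 T by rewrite /dom1 sT' dom1_tgt3.
have cT : cod1 T' = cod1 T by rewrite /cod1 sT' cod1_tgt3.
have j1 : cod1 a' = dom1 T' by rewrite cod1_id ta' dT.
have j2 : cod1 T' = dom1 b' by rewrite dom1_id sb' cT cod1_tgt3.
have j3 : cod1 T = dom1 a' by rewrite dom1_id sa'.
have j4 : cod1 b' = dom1 T by rewrite cod1_id tb' dom1_tgt3.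
have a1 : src3 T #1 a' = id2 (dom1 T) by rewrite -id3_comp1 // aK.
have a2 : a' #1 src3 T = id2 (cod1 T) by rewrite -id3_comp1 // Ka.
have b1 : tgt3 T #1 b' = id2 (dom1 T) by rewrite -id3_comp1 // bK dom1_tgt3.
have b2 : b' #1 tgt3 T = id2 (cod1 T) by rewrite -id3_comp1 // Kb cod1_tgt3.
have ja : cod1 (src3 T) = dom1 a' by rewrite cod1_id dom1_id sa'.
have jb : cod1 b' = dom1 (tgt3 T) by rewrite dom1_id cod1_id tb'.
have jc : cod1 a' = dom1 (tgt3 T) by rewrite dom1_id cod1_id ta' dom1_tgt3.
have j0 : cod1 a' = dom1 T by rewrite cod1_id.
have jd : tgt2 (tgt3 T) = src2 b' by rewrite sb'.
have je : tgt2 (src3 T) = src2 a' by rewrite sa'.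
have jf : tgt2 (src3 T) = src2 b' by rewrite sb' cod1_tgt3.
have sK : src3 (a' #1 T' #1 b') = a'.
  apply: id3_inj; rewrite !(src3_comp1, cod1_comp1) // !src3_id sT'.
  rewrite !id3_comp1 ?(law_tgt_comp (cat_12 C)) ?ta' ?dom1_tgt3 //.
  rewrite comp1A // ?cod1_id ?dom1_id ?jd // b1.
  by rewrite comp1_id // cod1_id.
have tK : tgt3 (a' #1 T' #1 b') = b'.
  apply: id3_inj; rewrite !(tgt3_comp1, cod1_comp1) // !tgt3_id tT'.
  rewrite !id3_comp1 ?(law_tgt_comp (cat_12 C)) ?ta' ?dom1_tgt3 //.
  by rewrite a2 id_comp1 // dom1_id sb' cod1_tgt3.
have dK : cod1 T = dom1 (a' #1 T' #1 b').
  by rewrite !dom1_comp1 ?cod1_comp1.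
have cK : cod1 (a' #1 T' #1 b') = dom1 T by rewrite !cod1_comp1 ?cod1_comp1.
split=> //.
(* Interchange turns [T #1 K], with [K] the adjoint, into
   [(T' #1 b') #2 (T #1 b')]. *)
- transitivity ((src3 T #2 T) #1 ((a' #1 T' #1 b') #2 b')).
    by rewrite id_comp2 // comp2_id.
  rewrite interchange12 ?tgt3_id ?tK ?src3_id //; last by rewrite -dK cod1_id.
  rewrite comp1A // -[src3 T #1 (_ #1 _)]comp1A ?dom1_comp1 //.
  rewrite a1 id_comp1 ?dom1_comp1 // -interchange12 ?tT' ?tgt3_id ?src3_id //.
  by rewrite KT id_comp2 ?src3_id.
transitivity ((a' #2 (a' #1 T' #1 b')) #1 (T #2 tgt3 T)).
  by rewrite id_comp2 // comp2_id.
rewrite interchange12 ?tgt3_id ?sK ?src3_id //.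
rewrite [X in _ #2 X]comp1A ?cod1_comp1 // b2 comp1_id ?cod1_comp1 //.
rewrite -interchange12 ?tgt3_id ?src3_id // ?TK ?id_comp2 ?src3_id //.
Qed.

Lemma comp0_comp1 U S T : cod1 S = dom1 T -> endo U -> endo S ->
  U #0 (S #1 T) = (U #0 S) #1 (cod1 U #0 T).
Proof.
by move=> st eU eS; rewrite -interchange01 ?dom1_id2 // comp1_id.
Qed.
Lemma comp1_comp0 U S T : cod1 S = dom1 T -> endo U -> endo S ->
  (S #1 T) #0 U = (S #0 U) #1 (T #0 cod1 U).
Proof.
by move=> st eU eS; rewrite -interchange01 ?dom1_id2 // comp1_id.
Qed.

(** Both sides are [S #0 T]. *)
Lemma comp0_slide S T : endo S -> endo T ->
  (dom1 S #0 T) #1 (S #0 cod1 T) = (S #0 dom1 T) #1 (cod1 S #0 T).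
Proof.
move=> eS eT; rewrite -!interchange01 ?(dom1_id2, cod1_id2) //.
- by rewrite !(id_comp1, comp1_id).
- by rewrite /endo dom1_id2.
by rewrite /endo dom1_id2.
Qed.
Lemma whisker1_comp2 a S T : tgt3 S = src3 T -> tgt2 a = dom1 S ->
  (a #1 S) #2 (a #1 T) = a #1 (S #2 T).
Proof.
move=> st aS; rewrite -interchange12 ?tgt3_id ?src3_id ?cod1_id //.
by rewrite id_comp2 ?src3_id.
Qed.
Lemma comp2_whisker1 a S T : tgt3 S = src3 T -> cod1 S = src2 a ->
  (S #1 a) #2 (T #1 a) = (S #2 T) #1 a.
Proof.
move=> st aS; rewrite -interchange12 ?tgt3_id ?src3_id ?dom1_id //.
by rewrite id_comp2 ?src3_id.
Qed.
Lemma whisker0_comp2 A B S T : tgt3 S = src3 T ->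
  endo S -> endo1 A -> endo1 B ->
  A #0 (S #2 T) #0 B = (A #0 S #0 B) #2 (A #0 T #0 B).
Proof.
move=> st eS eA eB; have eT : endo T.
  by rewrite /endo /dom1 -st dom1_tgt3.
have eA2 := endo_id2 eA; have eB2 := endo_id2 eB.
have idA : id3 (id2 A) #2 id3 (id2 A) = A by rewrite id_comp2 ?src3_id.
have idB : id3 (id2 B) #2 id3 (id2 B) = B by rewrite id_comp2 ?src3_id.
rewrite -[in LHS]idA -[in LHS]idB !interchange02 ?tgt3_id ?src3_id //.
  by rewrite tgt3_comp0 ?src3_comp0 ?tgt3_id ?src3_id ?st.
exact: endo_comp0.
Qed.
Lemma dom1_id_src3 T : dom1 (src3 T) = dom1 T. Proof. exact: dom1_id. Qed.
Lemma cod1_id_src3 T : cod1 (src3 T) = cod1 T. Proof. exact: cod1_id. Qed.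
Lemma dom1_id_tgt3 T : dom1 (tgt3 T) = dom1 T.
Proof. by rewrite dom1_id dom1_tgt3. Qed.
Lemma cod1_id_tgt3 T : cod1 (tgt3 T) = cod1 T.
Proof. by rewrite cod1_id cod1_tgt3. Qed.
End ThreeCells.

(** * Boundaries and normal forms of whiskered composites *)

Section RepBoundaries.
Variables (G : groupType) (C : strict3cat) (r : threerep G C).
Notation x := (rep_obj r).
Notation ρ := (rho r).
Notation φ := (phi r).
Notation Φ := (Phi r).
Implicit Types (a b c d g h : G).

Lemma endo1_rho g : endo1 x (ρ g).
Proof. by case: (rho_iso r g). Qed.
Lemma src2_phi h g : src2 (φ h g) = (ρ h #0 ρ g)%a1.
Proof. by case: (phi_iso r h g) => -[]. Qed.
Lemma tgt2_phi h g : tgt2 (φ h g) = ρ (h * g).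
Proof. by case: (phi_iso r h g) => -[]. Qed.
Lemma dom1_phi h g : dom1 (φ h g) = (ρ h #0 ρ g)%a1.
Proof. by rewrite dom1_id src2_phi. Qed.
Lemma cod1_phi h g : cod1 (φ h g) = ρ (h * g).
Proof. by rewrite cod1_id tgt2_phi. Qed.
Lemma endo_phi h g : endo x (φ h g).
Proof. by rewrite /endo dom1_phi; apply: endo1_comp; exact: endo1_rho. Qed.
Lemma src3_Phi a b c :
  src3 (Φ a b c) = ((ρ a #0 φ b c) #1 φ a (b * c))%a2.
Proof. by case: (Phi_iso r a b c) => -[]. Qed.
Lemma tgt3_Phi a b c :
  tgt3 (Φ a b c) = ((φ a b #0 ρ c) #1 φ (a * b) c)%a2.
Proof. by case: (Phi_iso r a b c) => -[]. Qed.
Lemma inverse3_Phi a b c : inverse3 (Φ a b c) (inv3 (Φ a b c)).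
Proof. by case: (Phi_iso r a b c) => _ [U hU]; rewrite (inv3_eq hU). Qed.
End RepBoundaries.

#[global] Hint Rewrite dom1_id_src3 cod1_id_src3 dom1_id_tgt3 cod1_id_tgt3
  dom1_phi cod1_phi dom1_id2 cod1_id2 : boundary.
#[global] Hint Resolve endo_phi : boundary.

(** Solves the side conditions of the calculus.  Boundary 1-arrows are compared
    after reassociating [#0] to the right and products in [G] to the left. *)
Ltac boundary :=
  lazymatch goal with
  | |- endo _ (comp3_0 _ _) => apply: endo_comp0; boundary
  | |- endo _ (comp3_1 _ _) => apply: endo_comp1; boundary
  | |- endo _ (id3 (id2 _)) => apply: endo_id2; boundary
  | |- endo _ _ => solve [eauto with boundary]
  | |- endo1 _ (comp1_0 _ _) => apply: endo1_comp; boundary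
  | |- endo1 _ (rho _ _) => exact: endo1_rho
  | |- endo1 _ (id1 _) => exact: endo1_id
  | |- endo1 _ (dom1 ?T) => lazymatch goal with |- endo1 ?x _ => change (endo x T) end; boundary
  | |- endo1 _ (cod1 _) => apply: endo1_cod; boundary
  | |- endo1 _ _ => assumption
  | |- _ = _ => boundary_simp; try reflexivity
  end
with boundary_simp :=
  repeat first
  [ rewrite dom1_comp1; [|solve [boundary]]
  | rewrite cod1_comp1; [|solve [boundary]]
  | match goal with r : threerep _ _ |- _ =>
      rewrite (@dom1_comp0 _ (rep_obj r)); [|solve [boundary] ..] end
  | match goal with r : threerep _ _ |- _ =>
      rewrite (@cod1_comp0 _ (rep_obj r)); [|solve [boundary] ..] end
  | progress autorewrite with boundary
  | match goal with
    | H : cod1 ?u = _ |- context [cod1 ?u] => rewrite H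
    | H : dom1 ?u = _ |- context [dom1 ?u] => rewrite H
    end
  | match goal with r : threerep _ _ |- _ =>
      rewrite (@endo1_comp0A _ (rep_obj r)); [|solve [boundary] ..] end
  | rewrite mulgA
  | match goal with H : strictly_unital ?r |- _ => first
     [ rewrite (proj1 H) | rewrite mulg1 | rewrite mul1g
     | rewrite (@endo1_comp0_id _ (rep_obj r)); [|solve [boundary]]
     | rewrite (@endo1_id_comp0 _ (rep_obj r)); [|solve [boundary]] ] end ].

(** Moves [id3] down to the generating 2-arrows. *)
Ltac push_id3 := repeat first
  [ match goal with r : threerep _ _ |- _ =>
      rewrite (@id3_comp0 _ (rep_obj r)); [|solve [push_id3; boundary] ..] end
  | rewrite id3_comp1; [|solve [rewrite -cod1_id -dom1_id; push_id3; boundary]] ].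

(** Distributes whiskering over [#1], leaving a right-nested [#1]-composite of
    right-nested [#0]-products. *)
Ltac whisker_normal := repeat first
  [ progress push_id3
  | match goal with r : threerep _ _ |- _ => first
     [ rewrite (@comp0_comp1 _ (rep_obj r)); [|solve [boundary] ..]
     | rewrite (@comp1_comp0 _ (rep_obj r)); [|solve [boundary] ..]
     | rewrite (@id23_comp0 _ (rep_obj r)); [|solve [boundary] ..]
     | rewrite (@comp0A _ (rep_obj r)); [|solve [boundary] ..] ] end
  | rewrite comp1A; [|solve [boundary] ..]
  | progress boundary_simp ].

Section RepCells.
Variables (G : groupType) (C : strict3cat) (r : threerep G C).
Notation x := (rep_obj r).
Notation ρ := (rho r).
Notation Φ := (Phi r).
Implicit Types (a b c d g h : G).
Local Open Scope arr3_scope.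

Lemma dom1_Phi a b c : dom1 (Φ a b c) = (ρ a #0 (ρ b #0 ρ c))%a1.
Proof.
by rewrite /dom1 src3_Phi -dom1_id; push_id3; boundary.
Qed.
Lemma cod1_Phi a b c : cod1 (Φ a b c) = ρ (a * b * c).
Proof.
by rewrite /cod1 src3_Phi -cod1_id; push_id3; boundary.
Qed.
Lemma endo_Phi a b c : endo x (Φ a b c).
Proof. by rewrite /endo dom1_Phi; boundary. Qed.
End RepCells.
#[global] Hint Rewrite dom1_Phi cod1_Phi : boundary.
#[global] Hint Resolve endo_Phi : boundary.

(** * The graded category of cells and its tensor product *)

Section CellCategory.
Variables (G : groupType) (C : strict3cat) (r : threerep G C).
Notation x := (rep_obj r).
Notation ρ := (rho r).
Implicit Types (a b c d g h : G).
Local Open Scope arr3_scope.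

(** The grade is recorded because [rho] need not be injective, while the tensor
    product depends on the grades through [phi]. *)
Record cell := Cell {
  grade : G;
  cell2 : arr2 C;
  cell_endo : endo x cell2;
  cell_cod1 : cod1 cell2 = ρ grade }.

Definition cellhom (u v : cell) :=
  {T : arr3 C | hom3 (cell2 u) (cell2 v) T /\ grade u = grade v}.

Lemma cellhom_eq (u v : cell) (S T : cellhom u v) : sval S = sval T -> S = T.
Proof.
case: S T => [S pS] [T pT] /= e; subst T.
by rewrite (proof_irrelevance _ pS pT).
Qed.

Lemma cell_id_subproof u : hom3 (cell2 u) (cell2 u) (cell2 u) /\ grade u = grade u.
Proof. by split=> //; split; rewrite (src3_id, tgt3_id). Qed.
Definition cell_id u : cellhom u u := exist _ _ (cell_id_subproof u).

Lemma cell_comp_subproof u v w (T : cellhom v w) (S : cellhom u v) :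
  hom3 (cell2 u) (cell2 w) (sval S #2 sval T) /\ grade u = grade w.
Proof.
case: S T => [S [[sS tS] uv]] [T [[sT tT] vw]] /=; split; last by rewrite uv.
by split; rewrite (src3_comp2, tgt3_comp2) // tS.
Qed.
Definition cell_comp u v w (T : cellhom v w) (S : cellhom u v) : cellhom u w :=
  exist _ _ (cell_comp_subproof T S).

Program Definition cells : category :=
  {| Ob := cell; Hom := cellhom; idm := cell_id; Defs.comp := cell_comp |}.
Next Obligation.
by apply: cellhom_eq; case: m => [S [[sS tS] uv]] /=; rewrite comp2_id.
Qed.
Next Obligation.
by apply: cellhom_eq; case: m => [S [[sS tS] uv]] /=; rewrite id_comp2.
Qed.
Next Obligation.
apply: cellhom_eq; case: m n p => [S [[sS tS] ?]] [T [[sT tT] ?]] [U [[sU tU] ?]].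
by rewrite /= comp2A ?tU ?sT ?tT.
Qed.

Section CellHom.
Variables (u v : cell) (S : cellhom u v).
Lemma src3_hom : src3 (sval S) = cell2 u. Proof. by case: S => ? [[]]. Qed.
Lemma tgt3_hom : tgt3 (sval S) = cell2 v. Proof. by case: S => ? [[]]. Qed.
Lemma grade_hom : grade u = grade v. Proof. by case: S => ? []. Qed.
Lemma endo_hom : endo x (sval S).
Proof. by rewrite /endo /dom1 src3_hom -dom1_id; exact: cell_endo. Qed.
Lemma cod1_hom : cod1 (sval S) = ρ (grade u).
Proof. by rewrite /cod1 src3_hom -cod1_id; exact: cell_cod1. Qed.
End CellHom.
End CellCategory.
#[global] Hint Rewrite cell_cod1 cod1_hom : boundary.
#[global] Hint Resolve cell_endo endo_hom : boundary.

Section CellTensor.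
Variables (G : groupType) (C : strict3cat) (r : threerep G C).
Notation x := (rep_obj r).
Notation ρ := (rho r).
Notation φ := (phi r).
Notation Φ := (Phi r).
Notation cell := (cell r).
Implicit Types (a b c d g h : G) (u v w : cell).
Local Open Scope arr3_scope.

Definition ten2 a b (s t : arr2 C) : arr2 C := ((s #0 t) #1 φ a b)%a2.
Definition ten3 a b (S T : arr3 C) : arr3 C := (S #0 T) #1 φ a b.

Lemma id3_ten u v : id3 (ten2 (grade u) (grade v) (cell2 u) (cell2 v))
  = ten3 (grade u) (grade v) (cell2 u) (cell2 v).
Proof. rewrite /ten2; push_id3. done. Qed.

Lemma ten_endo u v : endo x (ten2 (grade u) (grade v) (cell2 u) (cell2 v)).
Proof. rewrite id3_ten /ten3; boundary. Qed.
Lemma ten_cod1 u v : cod1 (ten2 (grade u) (grade v) (cell2 u) (cell2 v))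
  = ρ (grade u * grade v).
Proof. rewrite id3_ten /ten3; boundary. Qed.
Definition ten u v : cell := Cell (ten_endo u v) (ten_cod1 u v).

Lemma grade_ten u v : grade (ten u v) = grade u * grade v. Proof. by []. Qed.
Lemma cell2_ten u v :
  id3 (cell2 (ten u v)) = ten3 (grade u) (grade v) (cell2 u) (cell2 v).
Proof. exact: id3_ten. Qed.

Lemma tenh_subproof u u' v v' (S : cellhom u u') (T : cellhom v v') :
  hom3 (cell2 (ten u v)) (cell2 (ten u' v'))
       (ten3 (grade u) (grade v) (sval S) (sval T))
  /\ grade (ten u v) = grade (ten u' v').
Proof.
split; last by rewrite /= (grade_hom S) (grade_hom T).
rewrite /ten3; split.
  rewrite src3_comp1; last by boundary.
  by rewrite (@src3_comp0 _ x) ?src3_hom ?src3_id; boundary.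
rewrite tgt3_comp1; last by boundary.
rewrite (@tgt3_comp0 _ x) ?tgt3_hom ?tgt3_id; [|boundary..].
by rewrite /= (grade_hom S) (grade_hom T).
Qed.
Definition tenh u u' v v' (S : cellhom u u') (T : cellhom v v') :
  cellhom (ten u v) (ten u' v') := exist _ _ (tenh_subproof S T).

Definition asc3 a b c (s t q : arr3 C) : arr3 C := (s #0 t #0 q) #1 Φ a b c.

(** The two bracketings of a triple tensor product are the same product of
    3-arrows followed by the source, resp. the target, of [Phi]; this is what
    makes whiskered [Phi] an associator. *)
Section Nested.
Variables (a b c : G) (S T U : arr3 C).
Hypotheses (eS : endo x S) (eT : endo x T) (eU : endo x U).
Hypotheses (cS : cod1 S = ρ a) (cT : cod1 T = ρ b) (cU : cod1 U = ρ c).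

Lemma ten3_right : ten3 a (b * c) S (ten3 b c T U) = (S #0 T #0 U) #1 src3 (Φ a b c).
Proof. rewrite src3_Phi /ten3; whisker_normal; done. Qed.
Lemma ten3_left : ten3 (a * b) c (ten3 a b S T) U = (S #0 T #0 U) #1 tgt3 (Φ a b c).
Proof. rewrite tgt3_Phi /ten3; whisker_normal; done. Qed.
End Nested.

Lemma id3_cells u v w : id3 (cell2 u #0 cell2 v #0 cell2 w)%a2
  = cell2 u #0 cell2 v #0 cell2 w.
Proof. by push_id3. Qed.

Lemma asc_subproof u v w :
  hom3 (cell2 (ten u (ten v w))) (cell2 (ten (ten u v) w))
       (asc3 (grade u) (grade v) (grade w) (cell2 u) (cell2 v) (cell2 w))
  /\ grade (ten u (ten v w)) = grade (ten (ten u v) w).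
Proof.
split; last by rewrite /= mulgA.
split; apply: id3_inj; rewrite !(cell2_ten, grade_ten).
  rewrite ten3_right; [|boundary..]; rewrite src3_comp1; last by boundary.
  rewrite -id3_cells src3_id id3_comp1 //.
  by rewrite -cod1_id -dom1_id dom1_id -/(dom1 _); push_id3; boundary.
rewrite ten3_left; [|boundary..]; rewrite tgt3_comp1; last by boundary.
rewrite -id3_cells tgt3_id id3_comp1 //.
by rewrite -cod1_id dom1_tgt3; push_id3; boundary.
Qed.
Definition asc u v w : cellhom (ten u (ten v w)) (ten (ten u v) w) :=
  exist _ _ (asc_subproof u v w).

Lemma src3_invPhi a b c : src3 (inv3 (Φ a b c)) = tgt3 (Φ a b c).
Proof. by case: (inverse3_Phi r a b c) => -[]. Qed.
Lemma tgt3_invPhi a b c : tgt3 (inv3 (Φ a b c)) = src3 (Φ a b c).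
Proof. by case: (inverse3_Phi r a b c) => -[]. Qed.
Lemma dom1_invPhi a b c : dom1 (inv3 (Φ a b c)) = (ρ a #0 (ρ b #0 ρ c))%a1.
Proof. by rewrite /dom1 src3_invPhi dom1_tgt3 dom1_Phi. Qed.
Lemma cod1_invPhi a b c : cod1 (inv3 (Φ a b c)) = ρ (a * b * c).
Proof. by rewrite /cod1 src3_invPhi cod1_tgt3 cod1_Phi. Qed.
Lemma endo_invPhi a b c : endo x (inv3 (Φ a b c)).
Proof. by rewrite /endo dom1_invPhi; boundary. Qed.
End CellTensor.
#[global] Hint Rewrite dom1_invPhi cod1_invPhi : boundary.
#[global] Hint Resolve endo_invPhi : boundary.

Ltac source_target :=
  repeat first
  [ rewrite src3_comp1; [|solve [boundary]]
  | rewrite tgt3_comp1; [|solve [boundary]]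
  | match goal with r : threerep _ _ |- _ => first
     [ rewrite (@src3_comp0 _ (rep_obj r)); [|solve [boundary] ..]
     | rewrite (@tgt3_comp0 _ (rep_obj r)); [|solve [boundary] ..] ] end
  | rewrite src3_id | rewrite tgt3_id
  | rewrite src3_Phi | rewrite tgt3_Phi
  | rewrite src3_invPhi | rewrite tgt3_invPhi ].

Ltac source_target_eq := source_target; apply: id3_inj; whisker_normal; try reflexivity.

Section CellAssociator.
Variables (G : groupType) (C : strict3cat) (r : threerep G C).
Notation x := (rep_obj r).
Notation ρ := (rho r).
Notation φ := (phi r).
Notation Φ := (Phi r).
Notation cell := (cell r).
Implicit Types (a b c d g h : G) (u v w : cell).
Local Open Scope arr3_scope.

Definition ascV3 a b c (s t q : arr3 C) : arr3 C := (s #0 t #0 q) #1 inv3 (Φ a b c).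

Lemma cells_bnd u v w : tgt2 (cell2 u #0 cell2 v #0 cell2 w)%a2
  = dom1 (Φ (grade u) (grade v) (grade w)).
Proof. by rewrite -cod1_id; push_id3; boundary. Qed.

Lemma asc_inverse u v w :
  inverse3 (sval (asc u v w))
    (ascV3 (grade u) (grade v) (grade w) (cell2 u) (cell2 v) (cell2 w)).
Proof.
have [[sV tV] PK KP] := inverse3_Phi r (grade u) (grade v) (grade w).
have bP := cells_bnd u v w.
have bV : tgt2 (cell2 u #0 cell2 v #0 cell2 w)%a2
    = dom1 (inv3 (Φ (grade u) (grade v) (grade w))).
  by rewrite bP dom1_invPhi dom1_Phi.
rewrite /= /asc3 /ascV3 -id3_cells; split.
- split; rewrite !(src3_comp1, tgt3_comp1) ?cod1_id //.
    by rewrite src3_id tgt3_id sV.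
  by rewrite src3_id tgt3_id tV.
- by rewrite whisker1_comp2 // PK -id3_comp1 ?src3_comp1_id.
rewrite whisker1_comp2 // KP -id3_comp1 ?tgt3_comp1 ?tgt3_id //.
- by rewrite cod1_id.
by rewrite dom1_tgt3.
Qed.

Lemma ascV_subproof u v w :
  hom3 (cell2 (ten (ten u v) w)) (cell2 (ten u (ten v w)))
    (ascV3 (grade u) (grade v) (grade w) (cell2 u) (cell2 v) (cell2 w))
  /\ grade (ten (ten u v) w) = grade (ten u (ten v w)).
Proof.
split; last by rewrite /= mulgA.
by have [] := asc_inverse u v w; rewrite src3_hom tgt3_hom.
Qed.
Definition ascV u v w : cellhom (ten (ten u v) w) (ten u (ten v w)) :=
  exist _ _ (ascV_subproof u v w).

Local Notation "1[ a ]" := (@idm (cells r) a).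
Local Notation "S ;; T" := (@Defs.comp (cells r) _ _ _ T S) (at level 50, left associativity).

Lemma ascK u v w : asc u v w ;; ascV u v w = 1[_].
Proof.
by apply: cellhom_eq; case: (asc_inverse u v w) => _ e _; rewrite /= e src3_hom.
Qed.
Lemma ascVK u v w : ascV u v w ;; asc u v w = 1[_].
Proof.
by apply: cellhom_eq; case: (asc_inverse u v w) => _ _ e; rewrite /= e tgt3_hom.
Qed.
Lemma tenh_id u v : tenh 1[u] 1[v] = 1[_].
Proof. by apply: cellhom_eq; rewrite /= id3_ten. Qed.
(** Interchange of [#2] with [#0] and with [#1]. *)
Lemma tenh_comp u u' u'' v v' v'' (S : cellhom u u') (S' : cellhom u' u'')
    (T : cellhom v v') (T' : cellhom v' v'') :
  tenh (S ;; S') (T ;; T') = tenh S T ;; tenh S' T'.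
Proof.
apply: cellhom_eq => /=; rewrite /ten3.
have -> : φ (grade u') (grade v') = φ (grade u) (grade v).
  by rewrite (grade_hom S) (grade_hom T).
rewrite (@interchange02 _ x) ?tgt3_hom ?src3_hom; [|boundary..].
rewrite -interchange12 ?tgt3_id ?src3_id //; last by boundary.
  by rewrite id_comp2 ?src3_id.
by rewrite (@tgt3_comp0 _ x) ?(@src3_comp0 _ x) ?tgt3_hom ?src3_hom; boundary.
Qed.
Lemma asc_nat u u' v v' w w' (S : cellhom u u') (T : cellhom v v') (U : cellhom w w') :
  tenh S (tenh T U) ;; asc u' v' w' = asc u v w ;; tenh (tenh S T) U.
Proof.
apply: cellhom_eq => /=; rewrite ten3_right ?ten3_left; [|boundary..].
rewrite /asc3.
have -> : Φ (grade u') (grade v') (grade w') = Φ (grade u) (grade v) (grade w).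
  by rewrite (grade_hom S) (grade_hom T) (grade_hom U).
have hom_src : src3 (sval S #0 sval T #0 sval U) = (cell2 u #0 cell2 v #0 cell2 w)%a2.
  by rewrite !(@src3_comp0 _ x) ?src3_hom; [|boundary..].
have hom_tgt : tgt3 (sval S #0 sval T #0 sval U) = (cell2 u' #0 cell2 v' #0 cell2 w')%a2.
  by rewrite !(@tgt3_comp0 _ x) ?tgt3_hom; [|boundary..].
rewrite -!id3_cells -!interchange12 ?src3_id ?tgt3_id ?hom_src ?hom_tgt //; [|boundary..].
  by rewrite comp2_id // id_comp2 // id_comp2 // comp2_id.
by push_id3; boundary.
Qed.

(** In normal form, all five terms are the product of the four cells followed
    by one term of the 3-cocycle condition. *)
Lemma pentagon u v w t :
  tenh 1[u] (asc v w t) ;; asc u (ten v w) t ;; tenh (asc u v w) 1[t]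
  = asc u v (ten w t) ;; asc (ten u v) w t.
Proof.
apply: cellhom_eq => /=; rewrite /asc3 /ten3 !cell2_ten /ten3.
have := Phi_cocycle r (grade u) (grade v) (grade w) (grade t).
whisker_normal => cocycle.
have zE : id3 (cell2 u #0 (cell2 v #0 (cell2 w #0 cell2 t)))%a2
  = cell2 u #0 (cell2 v #0 (cell2 w #0 cell2 t)) by push_id3.
have ztgt : tgt2 (cell2 u #0 (cell2 v #0 (cell2 w #0 cell2 t)))%a2
  = (ρ (grade u) #0 (ρ (grade v) #0 (ρ (grade w) #0 ρ (grade t))))%a1.
  by rewrite -cod1_id; push_id3; boundary.
rewrite -zE !whisker1_comp2 ?ztgt ?cocycle //.
- source_target_eq.
  (* The only boundary that needs an interchange: [phi] on the left two factors
     and [phi] on the right two factors are applied in either order. *)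
  have slide := @comp0_slide _ x (φ (grade u) (grade v)) (φ (grade w) (grade t))
     (endo_phi _ _ _) (endo_phi _ _ _).
  move: slide; whisker_normal => slide.
  rewrite -comp1A; [|boundary..]. rewrite slide. rewrite comp1A; boundary.
- by symmetry; boundary.
- by rewrite tgt3_comp2; source_target_eq.
- by rewrite dom1_comp2; [symmetry; boundary | source_target_eq].
- by source_target_eq.
by symmetry; boundary.
Qed.
End CellAssociator.

(** * Quotients for composition along 1-arrows *)

Section Quotients.
Variables (C : strict3cat).
Implicit Types S T R : arr3 C.
Local Open Scope arr3_scope.

(** [R] is the quotient [S^-1 #1 T].  A relation rather than an operation: the
    witness supplies the inverse of [S] in whichever form is at hand. *)
Definition lquot S T R := exists S', [/\ hinv S S', dom1 S = dom1 T & R = S' #1 T].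

Lemma lquot_uniq S T R R' : lquot S T R -> lquot S T R' -> R = R'.
Proof.
by move=> [S' [h _ ->]] [S'' [h' _ ->]]; rewrite (hinv_uniq h h').
Qed.

Lemma lquot_src S T R : lquot S T R -> lquot (src3 S) (src3 T) (src3 R).
Proof.
move=> [S' [hS st ->]]; exists (src3 S'); split.
- exact: hinv_id (hinv_src3 hS).
- by rewrite !dom1_id_src3.
by case: hS => _ s's _ _; rewrite src3_comp1 ?id3_comp1 // -/(cod1 _) s's.
Qed.

Lemma lquot_tgt S T R : lquot S T R -> lquot (tgt3 S) (tgt3 T) (tgt3 R).
Proof.
move=> [S' [hS st ->]]; exists (tgt3 S'); split.
- exact: hinv_id (hinv_tgt3 hS).
- by rewrite !dom1_id_tgt3.
case: hS => _ s's _ _.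
by rewrite tgt3_comp1 ?id3_comp1 ?cod1_tgt3 ?dom1_tgt3 // s's.
Qed.

(** Boundaries of quotients are quotients of boundaries, hence determined by
    those of [S] and [T]; this is how the sources and targets of [Gamma] are
    found. *)
Lemma lquot_glue S S' T T' R R' : lquot S T R -> lquot S' T' R' ->
  tgt3 S = src3 S' -> tgt3 T = src3 T' -> tgt3 R = src3 R'.
Proof.
move=> /lquot_tgt q /lquot_src q' eS eT; rewrite eS eT in q.
exact: id3_inj (lquot_uniq q q').
Qed.

Lemma lquot_comp2 S S' T T' R R' : lquot S T R -> lquot S' T' R' ->
  tgt3 S = src3 S' -> tgt3 T = src3 T' -> lquot (S #2 S') (T #2 T') (R #2 R').
Proof.
move=> [U [hU st ->]] [U' [hU' st' ->]] eS eT; exists (U #2 U'); split.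
- exact: hinv_comp2.
- by rewrite !dom1_comp2.
rewrite interchange12 //; first exact: hinv_comp2_glue eS hU hU'.
by case: hU => _ -> _ _.
Qed.

Definition hinvertible S := exists S', hinv S S'.

Lemma hinvertible_comp1 S T : cod1 S = dom1 T ->
  hinvertible S -> hinvertible T -> hinvertible (S #1 T).
Proof. by move=> st [S' hS] [T' hT]; exists (T' #1 S'); exact: hinv_comp1. Qed.

Lemma hinvertible_comp0 x S T : endo x S -> endo x T ->
  hinvertible S -> hinvertible T -> hinvertible (S #0 T).
Proof.
move=> eS eT [S' hS] [T' hT]; exists (S' #0 T').
exact: hinv_comp0 eS eT hS hT.
Qed.

Lemma inverse2_inv2 (a : arr2 C) : hinvertible a -> inverse2 a (inv2 a).
Proof.
by move=> [S' /hinv_src3]; rewrite src3_id => h; rewrite (inv2_eq h).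
Qed.

Lemma hinv_id2 (A : arr1 C) : hinv (id3 (id2 A)) (id3 (id2 A)).
Proof.
have e : A #1 A = id3 (id2 A) by apply: id_comp1; exact: dom1_id2.
by split; rewrite ?e ?cod1_id2 ?dom1_id2.
Qed.
Lemma hinvertible_id2 (A : arr1 C) : hinvertible (id3 (id2 A)).
Proof. by exists (id3 (id2 A)); exact: hinv_id2. Qed.

(** The adjoint provides the inverse. *)
Lemma hinvertible_inverse3 S T : inverse3 S T ->
  hinvertible (src3 S) -> hinvertible (tgt3 S) -> hinvertible S.
Proof.
move=> ST /inverse2_inv2 hs /inverse2_inv2 ht.
by exists (inv2 (src3 S) #1 T #1 inv2 (tgt3 S)); exact: hinv_adjoint.
Qed.
End Quotients.

(** * The 3-arrow Lambda as a composite of associators *)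

Section Lambda.
Variables (G : groupType) (C : strict3cat) (r : threerep G C).
Notation x := (rep_obj r).
Notation ρ := (rho r).
Notation φ := (phi r).
Notation Φ := (Phi r).
Notation cell := (cell r).
Implicit Types (a b c d e g h k : G) (u v w : cell).
Local Open Scope arr3_scope.

Lemma hinvertible_phi h g : hinvertible (φ h g).
Proof.
by case: (phi_iso r h g) => _ [b hb]; exists b; exact: hinv_id.
Qed.

Lemma hinvertible_Phi a b c : hinvertible (Φ a b c).
Proof.
apply: hinvertible_inverse3 (inverse3_Phi r a b c) _ _.
  rewrite src3_Phi; push_id3; apply: hinvertible_comp1; [boundary| |exact: hinvertible_phi].
  apply: (@hinvertible_comp0 _ x); [boundary|boundary|exact: hinvertible_id2|].
  exact: hinvertible_phi.
rewrite tgt3_Phi; push_id3; apply: hinvertible_comp1; [boundary| |exact: hinvertible_phi].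
apply: (@hinvertible_comp0 _ x); [boundary|boundary| |exact: hinvertible_id2].
exact: hinvertible_phi.
Qed.

Lemma inverse3_sym (S T : arr3 C) : inverse3 S T -> inverse3 T S.
Proof. by move=> [[sT tT] e e']; split; rewrite ?sT ?tT. Qed.

Lemma hinvertible_invPhi a b c : hinvertible (inv3 (Φ a b c)).
Proof.
have [S' h] := hinvertible_Phi a b c.
apply: hinvertible_inverse3 (inverse3_sym (inverse3_Phi r a b c)) _ _.
  by rewrite src3_invPhi; exists (tgt3 S'); exact: hinv_id (hinv_tgt3 h).
by rewrite tgt3_invPhi; exists (src3 S'); exact: hinv_id (hinv_src3 h).
Qed.

(** [Lambda] with the inverses of [g] and [h] replaced by arbitrary [g'] and
    [h'], so that it can be compared with [conj_comp]. *)
Definition Lambda_free h g e g' h' : arr3 C :=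
  ((ρ h #0 φ g e #0 (ρ g' #0 ρ h')) #1 (Φ h (g * e) g' #0 ρ h')
   #1 φ (h * g * e * g') h')
  #2 ((Φ h g e #0 (ρ g' #0 ρ h')) #1 (φ (h * g * e) g' #0 ρ h')
   #1 φ (h * g * e * g') h')
  #2 ((φ h g #0 (ρ e #0 ρ g' #0 ρ h')) #1 (φ (h * g) e #0 (ρ g' #0 ρ h'))
   #1 inv3 (Φ (h * g * e) g' h')).

Lemma Lambda_freeE h g e : Lambda r h g e = Lambda_free h g e g^-1 h^-1.
Proof. by []. Qed.

Lemma Lambda_free_glue12 h g e g' h' :
  tgt3 ((ρ h #0 φ g e #0 (ρ g' #0 ρ h')) #1 (Φ h (g * e) g' #0 ρ h')
   #1 φ (h * g * e * g') h')
  = src3 ((Φ h g e #0 (ρ g' #0 ρ h')) #1 (φ (h * g * e) g' #0 ρ h')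
   #1 φ (h * g * e * g') h').
Proof. source_target_eq. Qed.

Lemma Lambda_free_glue23 h g e g' h' :
  tgt3 ((Φ h g e #0 (ρ g' #0 ρ h')) #1 (φ (h * g * e) g' #0 ρ h')
   #1 φ (h * g * e * g') h')
  = src3 ((φ h g #0 (ρ e #0 ρ g' #0 ρ h')) #1 (φ (h * g) e #0 (ρ g' #0 ρ h'))
   #1 inv3 (Φ (h * g * e) g' h')).
Proof. source_target_eq. Qed.

Lemma Lambda_free_src h g e g' h' : id3 (src3 (Lambda_free h g e g' h')) =
  ((ρ h #0 φ g e #0 (ρ g' #0 ρ h')) #1 (ρ h #0 φ (g * e) g' #0 ρ h')
   #1 (φ h (g * e * g') #0 ρ h') #1 φ (h * g * e * g') h').
Proof.
rewrite /Lambda_free !src3_comp2 ?tgt3_comp2 ?Lambda_free_glue12 ?Lambda_free_glue23 //.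
source_target; whisker_normal; done.
Qed.

Lemma Lambda_free_tgt h g e g' h' : id3 (tgt3 (Lambda_free h g e g' h')) =
  ((φ h g #0 (ρ e #0 ρ g' #0 ρ h')) #1 (φ (h * g) e #0 (ρ g' #0 ρ h'))
   #1 (ρ (h * g * e) #0 φ g' h') #1 φ (h * g * e) (g' * h')).
Proof.
rewrite /Lambda_free !tgt3_comp2 ?Lambda_free_glue12 ?Lambda_free_glue23 //.
source_target; whisker_normal; done.
Qed.

Lemma Lambda_free_dom1 h g e g' h' : dom1 (Lambda_free h g e g' h')
  = (ρ h #0 (ρ g #0 (ρ e #0 (ρ g' #0 ρ h'))))%a1.
Proof. by rewrite -dom1_id_src3 Lambda_free_src; boundary. Qed.
Lemma Lambda_free_cod1 h g e g' h' : cod1 (Lambda_free h g e g' h')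
  = ρ (h * g * e * g' * h').
Proof. by rewrite -cod1_id_src3 Lambda_free_src; boundary. Qed.
Lemma Lambda_free_endo h g e g' h' : endo x (Lambda_free h g e g' h').
Proof. by rewrite /endo Lambda_free_dom1; boundary. Qed.

Definition Lambda_cells (h g w g' h' : cell) : arr3 C :=
  sval (conj_comp (W := cells r) (@tenh _ _ r) (@asc _ _ r) (@ascV _ _ r) h g w g' h').

(** The composite of associators depends on the five cells only through their
    product.  This lets one replace a cell by a composite cell of the same
    grade at the price of an invertible left factor, which cancels in
    quotients. *)
Lemma Lambda_cellsE (h g w g' h' : cell) : Lambda_cells h g w g' h' =
  (cell2 h #0 cell2 g #0 cell2 w #0 cell2 g' #0 cell2 h')
  #1 Lambda_free (grade h) (grade g) (grade w) (grade g') (grade h').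
Proof.
rewrite /Lambda_cells /= /asc3 /ascV3 /ten3 !cell2_ten /ten3.
have zE : id3 (cell2 h #0 (cell2 g #0 (cell2 w #0 (cell2 g' #0 cell2 h'))))%a2
  = cell2 h #0 (cell2 g #0 (cell2 w #0 (cell2 g' #0 cell2 h'))) by push_id3.
have ztgt : tgt2 (cell2 h #0 (cell2 g #0 (cell2 w #0 (cell2 g' #0 cell2 h'))))%a2
  = (ρ (grade h) #0 (ρ (grade g) #0 (ρ (grade w) #0 (ρ (grade g') #0 ρ (grade h')))))%a1.
  by rewrite -cod1_id; push_id3; boundary.
have := Lambda_free_glue12 (grade h) (grade g) (grade w) (grade g') (grade h').
have := Lambda_free_glue23 (grade h) (grade g) (grade w) (grade g') (grade h').
rewrite /Lambda_free; whisker_normal => glue23 glue12.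
rewrite -zE !whisker1_comp2 ?tgt3_comp2 ?dom1_comp2 ?glue12 ?glue23 ?ztgt //;
  by symmetry; boundary.
Qed.

End Lambda.

#[global] Hint Rewrite Lambda_free_dom1 Lambda_free_cod1 : boundary.
#[global] Hint Resolve Lambda_free_endo : boundary.

(** * The functors psi and the 3-arrows Gamma as quotients *)

Section Ratios.
Variables (G : groupType) (C : strict3cat) (r : threerep G C).
Notation x := (rep_obj r).
Notation ρ := (rho r).
Notation φ := (phi r).
Notation cell := (cell r).
Notation tensor := (@ten G C r).
Notation tensor_hom := (@tenh G C r).
Implicit Types (a b c d e g h k : G) (u v w : cell).
Local Open Scope arr3_scope.

Lemma gen_endo g : endo x (id2 (ρ g)). Proof. boundary. Qed.
Lemma gen_cod1 g : cod1 (id2 (ρ g)) = ρ g. Proof. exact: cod1_id2. Qed.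
Definition gen g : cell := Cell (gen_endo g) (gen_cod1 g).

(** On the cells given by identities of the [rho g], the product is a unit. *)
Lemma Lambda_cells_gen h g e g' h' :
  Lambda_cells (gen h) (gen g) (gen e) (gen g') (gen h') = Lambda_free r h g e g' h'.
Proof.
rewrite Lambda_cellsE /= -!(@id23_comp0 _ x); [|boundary..].
by rewrite id_comp1 // Lambda_free_dom1; symmetry; boundary.
Qed.

Lemma Lambda_free_inverse h g e g' h' :
  inverse3 (Lambda_free r h g e g' h') (inv3 (Lambda_free r h g e g' h')).
Proof.
have [T [e1 e2]] := @iso_conj_comp (cells r) tensor tensor_hom (@asc _ _ r)
  (@ascV _ _ r) (@tenh_id _ _ r) (@tenh_comp _ _ r)
  (@ascK _ _ r) (@ascVK _ _ r) (gen h) (gen g) (gen e) (gen g') (gen h').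
have iT : inverse3 (Lambda_free r h g e g' h') (sval T).
  rewrite -Lambda_cells_gen; split.
  - by split; rewrite ?(src3_hom, tgt3_hom).
  - by rewrite src3_hom; exact: (congr1 sval e1).
  by rewrite tgt3_hom; exact: (congr1 sval e2).
by rewrite (inv3_eq iT).
Qed.

Ltac invertible := 
  repeat first
  [ exact: hinvertible_phi | exact: hinvertible_id2 | exact: hinvertible_Phi
  | exact: hinvertible_invPhi
  | apply: hinvertible_comp1; [solve [boundary]| |]
  | apply: (@hinvertible_comp0 _ x); [solve [boundary] | solve [boundary] | | ] ].

Lemma Lcell_eq h g e : Lcell r h g e = src3 (Lambda_free r h g e g^-1 h^-1).
Proof.
by apply: id3_inj; rewrite Lambda_free_src /Lcell; push_id3.
Qed.
Lemma Rcell_eq h g e : Rcell r h g e = tgt3 (Lambda_free r h g e g^-1 h^-1).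
Proof.
by apply: id3_inj; rewrite Lambda_free_tgt /Rcell; push_id3.
Qed.

Lemma hinv_Lambda_adj h g :
  hinv (Lambda_free r h g 1 g^-1 h^-1) (Lambda_adj r h g 1).
Proof.
rewrite /Lambda_adj Lambda_freeE Lcell_eq Rcell_eq.
apply: hinv_adjoint; first exact: Lambda_free_inverse.
  by apply: inverse2_inv2; rewrite Lambda_free_src; invertible.
by apply: inverse2_inv2; rewrite Lambda_free_tgt; invertible.
Qed.

Hypothesis hr : strictly_unital r.

Lemma rho_1 : ρ 1 = id1 x. Proof. by case: hr. Qed.
Lemma phi_g1 g : φ g 1 = id2 (ρ g).
Proof.
apply: id3_inj; rewrite phi_1r (proj2 hr); push_id3.
by rewrite (@comp0_id _ x); boundary.
Qed.
Lemma phi_1g g : φ 1 g = id2 (ρ g).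
Proof.
apply: id3_inj; rewrite phi_1l (proj2 hr); push_id3.
by rewrite (@id_comp0 _ x); boundary.
Qed.

Lemma hinv_unit_cell g : hinv (φ g g^-1) (unit_cell r g).
Proof. by apply: hinv_id; apply: inverse2_inv2; exact: hinvertible_phi. Qed.
Lemma dom1_unit_cell g : dom1 (unit_cell r g) = id1 x.
Proof. by case: (hinv_unit_cell g) => <- _ _ _; rewrite cod1_phi mulgV rho_1. Qed.
Lemma cod1_unit_cell g : cod1 (unit_cell r g) = (ρ g #0 ρ g^-1)%a1.
Proof. by case: (hinv_unit_cell g) => _ -> _ _; rewrite dom1_phi. Qed.
Lemma endo_unit_cell g : endo x (unit_cell r g).
Proof. by rewrite /endo dom1_unit_cell; boundary. Qed.

(** The conjugate of the unit cell by [g] is [phi g g^-1], whose inverse is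
    [u_g]. *)
Lemma conj_unit g :
  (φ g 1 #0 ρ g^-1) #1 φ (g * 1) g^-1 = φ g g^-1.
Proof.
rewrite phi_g1 mulg1 -(@id23_comp0 _ x); [|boundary..].
by rewrite id_comp1 // dom1_phi.
Qed.

Lemma conj3E k f S T U : endo x S -> endo x T -> endo x U ->
  cod1 S = ρ k -> cod1 T = ρ f -> cod1 U = ρ k^-1 ->
  ten3 r (k * f) k^-1 (ten3 r k f S T) U
  = (S #0 T #0 U) #1 ((φ k f #0 ρ k^-1) #1 φ (k * f) k^-1).
Proof. by move=> eS eT eU cS cT cU; rewrite /ten3; whisker_normal. Qed.
#[local] Hint Rewrite dom1_unit_cell cod1_unit_cell : boundary.
#[local] Hint Resolve endo_unit_cell : boundary.

Lemma hinv_bounds S S' : endo x S -> hinv S S' ->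
  [/\ endo x S', dom1 S' = cod1 S & cod1 S' = dom1 S].
Proof.
move=> eS [ss' s's _ _]; split=> //.
by rewrite /endo -ss'; exact: endo1_cod.
Qed.

(** The outer factors [S] and [S'] cancel in the quotient, whatever invertible
    3-arrows they are; only the middle quotient survives, between [u_g] and the
    [phi]'s. *)
Lemma lquot_conj3 k f S S' T T' R :
  endo x S -> endo x S' -> endo x T -> endo x T' ->
  cod1 S = ρ k -> cod1 S' = ρ k^-1 -> cod1 T = ρ 1 -> cod1 T' = ρ f ->
  hinvertible S -> hinvertible S' -> lquot T T' R ->
  lquot (ten3 r (k * 1) k^-1 (ten3 r k 1 S T) S')
        (ten3 r (k * f) k^-1 (ten3 r k f S T') S') (psi_arr3 r f k R).
Proof.
move=> eS eS' eT eT' cS cS' cT cT' [SV hS] [S'V hS'] [TV [hT dT ->]].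
have [eSV dSV cSV] := hinv_bounds eS hS.
have [eS'V dS'V cS'V] := hinv_bounds eS' hS'.
have [eTV dTV cTV] := hinv_bounds eT hT.
rewrite !conj3E // conj_unit; exists (unit_cell r k #1 (SV #0 TV #0 S'V)); split.
- apply: hinv_comp1; [boundary | | exact: hinv_unit_cell].
  by apply: (hinv_comp0 _ eS' (hinv_comp0 eS eT hS hT) hS'); boundary.
- by boundary.
have [_ _ _ keyS] := hS; have [_ _ _ keyS'] := hS'.
have e : (SV #0 TV #0 S'V) #1 (S #0 T' #0 S') = ρ k #0 (TV #1 T') #0 ρ k^-1.
  rewrite -!(@interchange01 _ x) ?keyS ?keyS' ?cS ?cS' //; boundary.
rewrite /psi_arr3 -e !comp1A //; boundary.
Qed.

Lemma lquot_conj f (a b a' b' u v u' v' : cell) (A : cellhom a b)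
    (A' : cellhom a' b') (S : cellhom u v) (S' : cellhom u' v') R :
  grade a' = (grade a)^-1 -> grade u = 1 -> grade u' = f ->
  hinvertible (sval A) -> hinvertible (sval A') -> lquot (sval S) (sval S') R ->
  lquot (sval (tensor_hom (tensor_hom A S) A'))
    (sval (tensor_hom (tensor_hom A S') A')) (psi_arr3 r f (grade a) R).
Proof.
move=> ga' gu gu'; rewrite /=.
move: (endo_hom A) (endo_hom A') (endo_hom S) (endo_hom S').
move: (cod1_hom A) (cod1_hom A') (cod1_hom S) (cod1_hom S').
move: (sval A) (sval A') (sval S) (sval S'); rewrite ga' gu gu'.
by move=> *; exact: lquot_conj3.
Qed.

(** The same cancellation of the outer factors, with the adjoint of [Lambda^1]
    in place of [u_g]. *)
Lemma lquot_Lambda_free h g f A B B' A' T T' (w : arr2 C) :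
  endo x A -> endo x B -> endo x B' -> endo x A' -> endo x T -> endo x T' ->
  cod1 A = ρ h -> cod1 B = ρ g -> cod1 B' = ρ g^-1 -> cod1 A' = ρ h^-1 ->
  cod1 T = ρ 1 -> cod1 T' = ρ f ->
  hinvertible A -> hinvertible B -> hinvertible B' -> hinvertible A' ->
  lquot T T' (id3 w) ->
  lquot ((A #0 B #0 T #0 B' #0 A') #1 Lambda_free r h g 1 g^-1 h^-1)
    ((A #0 B #0 T' #0 B' #0 A') #1 Lambda_free r h g f g^-1 h^-1)
    (Gamma_arr3 r f h g w).
Proof.
move=> eA eB eB' eA' eT eT' cA cB cB' cA' cT cT'.
move=> [AV hA] [BV hB] [B'V hB'] [A'V hA'] [TV [hT dT ew]].
have [eAV dAV cAV] := hinv_bounds eA hA.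
have [eBV dBV cBV] := hinv_bounds eB hB.
have [eTV dTV cTV] := hinv_bounds eT hT.
have [eB'V dB'V cB'V] := hinv_bounds eB' hB'.
have [eA'V dA'V cA'V] := hinv_bounds eA' hA'.
have hL := hinv_Lambda_adj h g.
have [eL dL cL] := hinv_bounds (Lambda_free_endo _ _ _ _ _ _) hL.
rewrite Lambda_free_dom1 in cL; rewrite Lambda_free_cod1 in dL.
exists (Lambda_adj r h g 1 #1 (AV #0 BV #0 TV #0 B'V #0 A'V)); split.
- apply: hinv_comp1 hL; first by boundary.
  have h2 := hinv_comp0 eA eB hA hB.
  have h3 := hinv_comp0 (endo_comp0 eA eB) eT h2 hT.
  have h4 := hinv_comp0 (endo_comp0 (endo_comp0 eA eB) eT) eB' h3 hB'.
  apply: (hinv_comp0 _ eA' h4 hA'); boundary.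
- by boundary.
have wE : endo x w by rewrite ew; boundary.
have wD : dom1 w = id1 x by rewrite ew; boundary.
have wC : cod1 w = ρ f by rewrite ew; boundary.
have [_ _ _ keyA] := hA; have [_ _ _ keyA'] := hA'.
have [_ _ _ keyB] := hB; have [_ _ _ keyB'] := hB'.
have e : (AV #0 BV #0 TV #0 B'V #0 A'V) #1 (A #0 B #0 T' #0 B' #0 A')
   = ρ h #0 ρ g #0 id3 w #0 (ρ g^-1 #0 ρ h^-1).
  rewrite -!(@interchange01 _ x) ?keyA ?keyA' ?keyB ?keyB' ?cA ?cB ?cA' ?cB' -?ew; [|boundary..].
  rewrite -(@comp0A _ x _ (ρ g^-1)) //; boundary.
rewrite /Gamma_arr3 -e Lambda_freeE; move: (Lambda_adj r h g 1) eL dL cL {hL} => L eL dL cL.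
by rewrite !comp1A //; boundary.
Qed.

Lemma lquot_Lambda f (a b c c' b' a' : cell) (w : arr2 C) :
  grade b' = (grade b)^-1 -> grade a' = (grade a)^-1 ->
  grade c = 1 -> grade c' = f ->
  hinvertible (cell2 a) -> hinvertible (cell2 b) ->
  hinvertible (cell2 b') -> hinvertible (cell2 a') ->
  lquot (cell2 c) (cell2 c') (id3 w) ->
  lquot (Lambda_cells a b c b' a') (Lambda_cells a b c' b' a')
    (Gamma_arr3 r f (grade a) (grade b) w).
Proof.
move=> gb' ga' gc gc' ia ib ib' ia' q; rewrite !Lambda_cellsE gb' ga' gc gc'.
by apply: lquot_Lambda_free => //; rewrite ?cell_cod1 ?gb' ?ga' ?gc ?gc' //;
  exact: cell_endo.
Qed.
End Ratios.

(** * The laws of the action *)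

Section LquotInverse.
Variable C : strict3cat.
Implicit Types S T R : arr3 C.
Local Open Scope arr3_scope.

(** The inverse of a quotient is the quotient of the inverses. *)
Lemma lquot_inverse S S' T T' R : inverse3 S S' -> inverse3 T T' ->
  lquot S T R -> exists R', inverse3 R R'.
Proof.
move=> SS TT q; have [[sS' tS'] SK KS] := SS; have [[sT' tT'] TK KT] := TT.
have [U [hU dS eR]] := q.
have [U' hU'] : hinvertible S'.
  apply: hinvertible_inverse3 (inverse3_sym SS) _ _.
    by rewrite sS'; exists (tgt3 U); exact: hinv_id (hinv_tgt3 hU).
  by rewrite tS'; exists (src3 U); exact: hinv_id (hinv_src3 hU).
have q' : lquot S' T' (U' #1 T').
  exists U'; split=> //.
  by rewrite -[LHS]dom1_id_src3 -[RHS]dom1_id_src3 sS' sT' !dom1_id_tgt3.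
have g1 : tgt3 R = src3 (U' #1 T') by apply: lquot_glue q q' _ _.
have g2 : tgt3 (U' #1 T') = src3 R by apply: lquot_glue q' q _ _.
exists (U' #1 T'); split=> //.
  have := lquot_comp2 q q' (esym sS') (esym sT'); rewrite SK TK => q2.
  exact: lquot_uniq q2 (lquot_src q).
have := lquot_comp2 q' q tS' tT'; rewrite KS KT => q2.
exact: lquot_uniq q2 (lquot_tgt q).
Qed.
End LquotInverse.

Section TraceAction.
Variables (G : groupType) (C : strict3cat) (r : threerep G C).
Hypothesis hr : strictly_unital r.
Variable f : G.
Notation x := (rep_obj r).
Notation ρ := (rho r).
Notation φ := (phi r).
Notation cell := (cell r).
Notation tensor := (@ten G C r).
Notation tensor_hom := (@tenh G C r).
Implicit Types (a b c d e g h k : G) (T U : arr3 C) (w : arr2 C).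
Local Open Scope arr3_scope.
Notation "1[ a ]" := (@idm (cells r) a).
Notation psi2 := (psi_arr2 r f).
Notation psi3 := (psi_arr3 r f).
Notation Gamma := (Gamma_arr3 r f).

#[local] Hint Rewrite dom1_unit_cell cod1_unit_cell using assumption : boundary.
#[local] Hint Resolve endo_unit_cell : boundary.

Definition trace3 T := dom1 T = id1 x /\ cod1 T = ρ f.
Lemma trace3_id w : hom2 (id1 x) (ρ f) w -> trace3 w.
Proof. by case=> sw tw; split; rewrite ?dom1_id ?cod1_id. Qed.
Lemma trace3_endo T : trace3 T -> endo x T.
Proof. by case=> dT _; rewrite /endo dT; exact: endo1_id. Qed.

Lemma psi_id g w : hom2 (id1 x) (ρ f) w -> psi3 g (id3 w) = id3 (psi2 g w).
Proof.
move=> /trace3_id tw; have ew := trace3_endo tw; have [dw cw] := tw.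
by rewrite /psi_arr2; push_id3.
Qed.

Lemma psi_dom1 g T : trace3 T -> dom1 (psi3 g T) = id1 x.
Proof.
move=> tT; have eT := trace3_endo tT; have [dT cT] := tT.
by rewrite /psi_arr3; boundary.
Qed.
Lemma psi_cod1 g T : trace3 T -> cod1 (psi3 g T) = ρ (g * f * g^-1).
Proof.
move=> tT; have eT := trace3_endo tT; have [dT cT] := tT.
by rewrite /psi_arr3; boundary.
Qed.
Lemma psi_src g T : trace3 T -> src3 (psi3 g T) = psi2 g (src3 T).
Proof.
move=> tT; have eT := trace3_endo tT; have [dT cT] := tT.
by rewrite /psi_arr3; source_target.
Qed.
Lemma psi_tgt g T : trace3 T -> tgt3 (psi3 g T) = psi2 g (tgt3 T).
Proof.
move=> tT; have eT := trace3_endo tT; have [dT cT] := tT.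
by rewrite /psi_arr3; source_target.
Qed.

Lemma psi_comp2 g T U : trace3 T -> tgt3 T = src3 U ->
  psi3 g (T #2 U) = psi3 g T #2 psi3 g U.
Proof.
move=> tT TU; have eT := trace3_endo tT; have [dT cT] := tT.
have tU : trace3 U by rewrite /trace3 -dom1_id_src3 -cod1_id_src3 -TU dom1_id_tgt3 cod1_id_tgt3.
have eU := trace3_endo tU; have [dU cU] := tU.
have g0 : tgt3 (ρ g #0 T #0 ρ g^-1) = src3 (ρ g #0 U #0 ρ g^-1).
  by source_target; rewrite TU.
rewrite /psi_arr3 (@whisker0_comp2 _ x) //; [|exact: endo1_rho..].
rewrite -whisker1_comp2 //; last by rewrite -cod1_id; boundary.
rewrite -!(@id3_comp0 _ x (φ g f) (ρ g^-1)); [|boundary..].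
rewrite -!comp2_whisker1 //; try (by rewrite -?[src2 _]dom1_id; push_id3; boundary).
  by push_id3; source_target; rewrite TU.
by source_target; rewrite TU.
Qed.

Definition one : cell := gen r 1.
Definition trcell (w : Tr2_rho r f) : cell :=
  @Cell _ _ r f (proj1_sig w) (trace3_endo (trace3_id (proj2_sig w)))
    (proj2 (trace3_id (proj2_sig w))).

Lemma trhom_subproof (w w' : Tr2_rho r f) (m : Hom w w') :
  hom3 (cell2 (trcell w)) (cell2 (trcell w')) (proj1_sig m)
  /\ grade (trcell w) = grade (trcell w').
Proof. by case: m. Qed.
Definition trhom (w w' : Tr2_rho r f) (m : Hom w w') : cellhom (trcell w) (trcell w') :=
  exist _ _ (trhom_subproof m).

(** The quotient for the construction that leaves the middle cell alone; the
    inverse of the unit cell is an identity because [rho 1] is. *)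
Lemma lquot_one T : trace3 T -> lquot (id3 (cell2 one)) T T.
Proof.
case=> dT cT; exists (id3 (id2 (ρ 1))); split.
- exact: hinv_id2.
- by rewrite dom1_id2 dT rho_1.
by rewrite id_comp1 // dT rho_1.
Qed.

Definition conj_ob g (u : cell) : cell := tensor (tensor (gen r g) u) (gen r g^-1).
Definition conj_hom g u v (S : cellhom u v) : cellhom (conj_ob g u) (conj_ob g v) :=
  tensor_hom (tensor_hom 1[gen r g] S) 1[gen r g^-1].

Lemma lquot_conj_hom g u v u' v' (S : cellhom u v) (S' : cellhom u' v') R :
  grade u = 1 -> grade u' = f -> lquot (sval S) (sval S') R ->
  lquot (sval (conj_hom g S)) (sval (conj_hom g S')) (psi3 g R).
Proof.
by move=> gu gu' q; apply: (lquot_conj hr) => //; exact: hinvertible_id2.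
Qed.

Lemma grade_conj g u e : g * e = e * g -> grade u = e -> grade (conj_ob g u) = e.
Proof. by move=> ge ue; rewrite /= ue ge mulgK. Qed.
Lemma grade_conj1 g u : grade u = 1 -> grade (conj_ob g u) = 1.
Proof. by apply: grade_conj; rewrite mulg1 mul1g. Qed.

Lemma lquot_Gamma h g (w : Tr2_rho r f) :
  lquot (Lambda_cells (gen r h) (gen r g) one (gen r g^-1) (gen r h^-1))
        (Lambda_cells (gen r h) (gen r g) (trcell w) (gen r g^-1) (gen r h^-1))
        (Gamma h g (proj1_sig w)).
Proof.
apply: (lquot_Lambda hr) => //; try exact: hinvertible_id2.
exact: lquot_one (trace3_id (proj2_sig w)).
Qed.

Lemma psi_hom2 g w : g * f = f * g -> hom2 (id1 x) (ρ f) w ->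
  hom2 (id1 x) (ρ f) (psi2 g w).
Proof.
move=> gf tw; split.
  by rewrite -dom1_id -psi_id // psi_dom1 //; exact: trace3_id.
by rewrite -cod1_id -psi_id // psi_cod1 ?gf ?mulgK //; exact: trace3_id.
Qed.

Notation Lambda_hom h g w := (conj_comp (W := cells r) tensor_hom (@asc _ _ r)
  (@ascV _ _ r) (gen r h) (gen r g) w (gen r g^-1) (gen r h^-1)).

Lemma lquot_conj2_id h g (w : Tr2_rho r f) : g * f = f * g -> 
  lquot (sval (conj_hom h (conj_hom g 1[one])))
    (sval (conj_hom h (conj_hom g 1[trcell w])))
    (psi2 h (psi2 g (proj1_sig w))).
Proof.
move=> gf; have tw := proj2_sig w.
rewrite -psi_id; last exact: psi_hom2.
rewrite -psi_id //.
apply: lquot_conj_hom; [exact: grade_conj1 | exact: grade_conj |].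
by apply: lquot_conj_hom => //; exact: lquot_one (trace3_id tw).
Qed.

Lemma Gamma_src h g (w : Tr2_rho r f) : g * f = f * g ->
  src3 (Gamma h g (proj1_sig w)) = psi2 h (psi2 g (proj1_sig w)).
Proof.
move=> gf; rewrite -[RHS]tgt3_id; symmetry.
apply: lquot_glue (lquot_conj2_id h w gf) (lquot_Gamma h g w) _ _;
  by rewrite tgt3_hom src3_hom.
Qed.

Lemma hinvertible_gen g : hinvertible (cell2 (gen r g)).
Proof. exact: hinvertible_id2. Qed.

Lemma hinvertible_ten (u v : cell) : hinvertible (cell2 u) -> hinvertible (cell2 v) ->
  hinvertible (cell2 (tensor u v)).
Proof.
move=> iu iv; rewrite cell2_ten /ten3.
apply: hinvertible_comp1; [boundary | | exact: hinvertible_phi].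
by apply: (@hinvertible_comp0 _ x) => //; exact: cell_endo.
Qed.

Lemma lquot_conj_ten h g (w w' : Tr2_rho r f) (m : Hom w w') :
  lquot (sval (tensor_hom (tensor_hom 1[tensor (gen r h) (gen r g)] 1[one])
           1[tensor (gen r g^-1) (gen r h^-1)]))
    (sval (tensor_hom (tensor_hom 1[tensor (gen r h) (gen r g)] (trhom m))
           1[tensor (gen r g^-1) (gen r h^-1)]))
    (psi3 (h * g) (proj1_sig m)).
Proof.
apply: (lquot_conj hr) => //.
- by rewrite /= invgM.
- by apply: hinvertible_ten; exact: hinvertible_id2.
- by apply: hinvertible_ten; exact: hinvertible_id2.
apply: lquot_one; case: m => T [sT tT] /=.
rewrite /trace3 -dom1_id_src3 -cod1_id_src3 sT; exact: trace3_id (proj2_sig w).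
Qed.

Lemma Gamma_tgt h g (w : Tr2_rho r f) :
  tgt3 (Gamma h g (proj1_sig w)) = psi2 (h * g) (proj1_sig w).
Proof.
have tw := proj2_sig w.
rewrite -[RHS]src3_id -psi_id //.
have q := lquot_conj_ten h g (@idm (Tr2_rho r f) w).
by apply: lquot_glue (lquot_Gamma h g w) q _ _; rewrite tgt3_hom src3_hom.
Qed.

Lemma Gamma_inverse h g (w : Tr2_rho r f) :
  exists R, inverse3 (Gamma h g (proj1_sig w)) R.
Proof.
have inv u : exists S, inverse3 (sval (Lambda_hom h g u)) S.
  have [T [e1 e2]] := @iso_conj_comp (cells r) tensor tensor_hom (@asc _ _ r)
    (@ascV _ _ r) (@tenh_id _ _ r) (@tenh_comp _ _ r) (@ascK _ _ r) (@ascVK _ _ r)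
    (gen r h) (gen r g) u (gen r g^-1) (gen r h^-1).
  exists (sval T); split.
  - by split; rewrite ?(src3_hom, tgt3_hom).
  - by rewrite src3_hom; exact: (congr1 sval e1).
  by rewrite tgt3_hom; exact: (congr1 sval e2).
have [S hS] := inv one; have [T hT] := inv (trcell w).
exact: lquot_inverse hS hT (lquot_Gamma h g w).
Qed.

Lemma lquot_trhom (w w' : Tr2_rho r f) (m : Hom w w') :
  lquot (sval 1[one]) (sval (trhom m)) (proj1_sig m).
Proof.
apply: lquot_one; case: m => T [sT tT] /=.
rewrite /trace3 -dom1_id_src3 -cod1_id_src3 sT; exact: trace3_id (proj2_sig w).
Qed.

(** [conj_comp_nat] at the given morphism, divided by [conj_comp_nat] at the
    identity of the unit cell. *)
Lemma Gamma_nat h g (w w' : Tr2_rho r f) (m : Hom w w') : g * f = f * g ->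
  psi3 h (psi3 g (proj1_sig m)) #2 Gamma h g (proj1_sig w')
  = Gamma h g (proj1_sig w) #2 psi3 (h * g) (proj1_sig m).
Proof.
move=> gf.
have nat u v (S : cellhom u v) := congr1 sval
  (@conj_comp_nat (cells r) tensor tensor_hom (@asc _ _ r)
    (@ascV _ _ r) (@tenh_id _ _ r) (@tenh_comp _ _ r) (@ascK _ _ r) (@ascVK _ _ r)
    (@asc_nat _ _ r) (gen r h) (gen r g) (gen r g^-1) (gen r h^-1) u v S).
have q1 : lquot (sval (conj_hom h (conj_hom g 1[one])))
    (sval (conj_hom h (conj_hom g (trhom m)))) (psi3 h (psi3 g (proj1_sig m))).
  apply: lquot_conj_hom; [exact: grade_conj1 | exact: grade_conj |].
  by apply: lquot_conj_hom => //; exact: lquot_trhom.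
have qL := lquot_comp2 q1 (lquot_Gamma h g w').
have qR := lquot_comp2 (lquot_Gamma h g w) (lquot_conj_ten h g m).
apply: lquot_uniq (qL _ _) _; rewrite ?tgt3_hom ?src3_hom //.
have := qR _ _; rewrite !tgt3_hom !src3_hom => /(_ erefl erefl).
by move: (nat _ _ 1[one]) (nat _ _ (trhom m)) => /= <- <-.
Qed.

Lemma hinvertible_asc_gen k h g :
  hinvertible (sval (asc (gen r k) (gen r h) (gen r g))).
Proof.
rewrite /= /asc3; apply: hinvertible_comp1; [boundary | | exact: hinvertible_Phi].
by do 2?[apply: (@hinvertible_comp0 _ x); [boundary|boundary| |]]; exact: hinvertible_id2.
Qed.
Lemma hinvertible_ascV_gen k h g :
  hinvertible (sval (ascV (gen r k) (gen r h) (gen r g))).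
Proof.
rewrite /= /ascV3; apply: hinvertible_comp1; [boundary | | exact: hinvertible_invPhi].
by do 2?[apply: (@hinvertible_comp0 _ x); [boundary|boundary| |]]; exact: hinvertible_id2.
Qed.

Lemma lquot_conj_id g (w : Tr2_rho r f) :
  lquot (cell2 (conj_ob g one)) (cell2 (conj_ob g (trcell w))) (psi2 g (proj1_sig w)).
Proof.
have tw := proj2_sig w.
have := lquot_conj_hom g (S := 1[one]) (S' := 1[trcell w]) erefl erefl
  (lquot_one (trace3_id tw)).
by rewrite psi_id // /conj_hom !tenh_id.
Qed.

(** [conj_compA] at the given cell, divided by [conj_compA] at the unit cell.
    In [qB] and [qD] a pair of cells such as [h], [g] is tensored where [Gamma]
    has the single cell [h * g], and in [qC] the middle cell is the conjugate of
    [w] by [g]; both are absorbed by [lquot_Lambda]. *)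
Lemma Gamma_assoc k h g (w : Tr2_rho r f) : h * f = f * h -> g * f = f * g ->
  psi3 k (Gamma h g (proj1_sig w)) #2 Gamma k (h * g) (proj1_sig w)
  = Gamma k h (psi2 g (proj1_sig w)) #2 Gamma (k * h) g (proj1_sig w).
Proof.
move=> hf gf; have tw := proj2_sig w.
have coh u := congr1 sval
  (@conj_compA (cells r) tensor tensor_hom (@asc _ _ r)
    (@ascV _ _ r) (@tenh_id _ _ r) (@tenh_comp _ _ r) (@ascK _ _ r) (@ascVK _ _ r)
    (@asc_nat _ _ r) (@pentagon _ _ r) (gen r k) (gen r h) (gen r g) u
    (gen r g^-1) (gen r h^-1) (gen r k^-1)).
have qA : lquot (sval (conj_hom k (Lambda_hom h g one)))
    (sval (conj_hom k (Lambda_hom h g (trcell w)))) (psi3 k (Gamma h g (proj1_sig w))).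
  apply: lquot_conj_hom; last exact: lquot_Gamma.
    by apply: (@grade_conj1 h (conj_ob g one)); exact: grade_conj1.
  by apply: (@grade_conj h (conj_ob g (trcell w))) => //; exact: grade_conj.
have qB := @lquot_Lambda _ _ _ hr f (gen r k) (tensor (gen r h) (gen r g)) one (trcell w)
  (tensor (gen r g^-1) (gen r h^-1)) (gen r k^-1) (proj1_sig w)
  (esym (invgM _ _)) erefl erefl erefl (hinvertible_gen _)
  (hinvertible_ten (hinvertible_gen _) (hinvertible_gen _))
  (hinvertible_ten (hinvertible_gen _) (hinvertible_gen _)) (hinvertible_gen _)
  (lquot_one (trace3_id tw)).
have qC := @lquot_Lambda _ _ _ hr f (gen r k) (gen r h) (conj_ob g one) (conj_ob g (trcell w))
  (gen r h^-1) (gen r k^-1) (psi2 g (proj1_sig w))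
  erefl erefl (@grade_conj1 g one erefl) (@grade_conj g (trcell w) f gf erefl)
  (hinvertible_gen _) (hinvertible_gen _) (hinvertible_gen _) (hinvertible_gen _)
  (lquot_conj_id g w).
have qD := @lquot_Lambda _ _ _ hr f (tensor (gen r k) (gen r h)) (gen r g) one (trcell w)
  (gen r g^-1) (tensor (gen r h^-1) (gen r k^-1)) (proj1_sig w)
  erefl (esym (invgM _ _)) erefl erefl
  (hinvertible_ten (hinvertible_gen _) (hinvertible_gen _))
  (hinvertible_gen _) (hinvertible_gen _)
  (hinvertible_ten (hinvertible_gen _) (hinvertible_gen _))
  (lquot_one (trace3_id tw)).
(* The extra associators of [conj_compA] are outer factors, so the quotient
   is an identity. *)
have qX : lquot
  (sval (tensor_hom (tensor_hom (asc (gen r k) (gen r h) (gen r g)) 1[one])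
      (ascV (gen r g^-1) (gen r h^-1) (gen r k^-1))))
  (sval (tensor_hom (tensor_hom (asc (gen r k) (gen r h) (gen r g)) 1[trcell w])
      (ascV (gen r g^-1) (gen r h^-1) (gen r k^-1))))
  (psi2 (k * (h * g)) (proj1_sig w)).
  rewrite -psi_id //; apply: (lquot_conj hr) => //.
  - by rewrite /= !invgM.
  - exact: hinvertible_asc_gen.
  - exact: hinvertible_ascV_gen.
  exact: lquot_one (trace3_id tw).
have qAB := lquot_comp2 qA qB _ _.
have qL : lquot _ _ (_ #2 _ #2 _) := lquot_comp2 (qAB _ _) qX _ _.
have qR := lquot_comp2 qC qD _ _.
have idX : psi3 k (Gamma h g (proj1_sig w)) #2 Gamma k (h * g) (proj1_sig w)
    #2 psi2 (k * (h * g)) (proj1_sig w)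
  = psi3 k (Gamma h g (proj1_sig w)) #2 Gamma k (h * g) (proj1_sig w).
  rewrite comp2_id // tgt3_comp2 ?Gamma_tgt //.
  by apply: lquot_glue qA qB _ _; rewrite tgt3_hom src3_hom.
rewrite -idX; apply: lquot_uniq (qL _ _ _ _) _.
1-4: by rewrite ?tgt3_comp2 ?(tgt3_hom, src3_hom).
have := qR _ _; rewrite !tgt3_hom !src3_hom => /(_ erefl erefl).
have svalE (u v t : cells r) (S : Hom u v) (S' : Hom v t) :
  sval (Defs.comp S' S) = sval S #2 sval S' by [].
move: (coh one) (coh (trcell w)); rewrite !svalE => e1 ew.
by rewrite /Lambda_cells /conj_ob -e1 -ew.
Qed.
End TraceAction.

(** * Assembling the categorical action *)

Section NaturalIso.
Variables V W : category.
Implicit Types F : functor V W.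

Definition naturally_iso F F' := exists eta : nattrans F F', is_natiso eta.

Lemma naturally_iso_trans F F' F'' :
  naturally_iso F F' -> naturally_iso F' F'' -> naturally_iso F F''.
Proof.
move=> [eta ie] [eps ip].
have nat a b (m : Hom a b) :
    Defs.comp (Defs.comp (eps b) (eta b)) (fmap F m)
    = Defs.comp (fmap F'' m) (Defs.comp (eps a) (eta a)).
  by rewrite -Defs.compA naturality Defs.compA naturality -Defs.compA.
exists (NatTrans nat) => a; have [n [n1 n2]] := ie a; have [p [p1 p2]] := ip a.
exists (Defs.comp n p) => /=; split.
  by rewrite -Defs.compA [Defs.comp p _]Defs.compA p1 comp_idl.
by rewrite -Defs.compA [Defs.comp _ (Defs.comp n p)]Defs.compA n2 comp_idl.
Qed.

Lemma naturally_iso_sym F F' : naturally_iso F F' -> naturally_iso F' F.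
Proof.
move=> [eta ie].
pose inv a := constructive_indefinite_description _ (ie a).
have nat a b (m : Hom a b) :
    Defs.comp (sval (inv b)) (fmap F' m) = Defs.comp (fmap F m) (sval (inv a)).
  move: (svalP (inv a)) (svalP (inv b)).
  move: (sval (inv a)) (sval (inv b)) => i j [_ a2] [b1 _].
  rewrite -[LHS]comp_idr -a2 Defs.compA -[Defs.comp (Defs.comp _ (fmap F' m)) _]Defs.compA.
  by rewrite -naturality Defs.compA b1 comp_idl.
exists (NatTrans nat) => a; exists (eta a) => /=.
by have [a1 a2] := svalP (inv a).
Qed.
End NaturalIso.

(** [psi g] and [psi g^-1] compose to [psi 1] in both orders. *)
Lemma action_equivalence (K : groupType) (W : category) (psi : K -> functor W W)
    (Gamma : forall h g, nattrans (fcomp (psi h) (psi g)) (psi (h * g))) :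
  (forall h g, is_natiso (Gamma h g)) -> naturally_iso (psi 1) (fid W) ->
  forall g, is_equivalence (psi g).
Proof.
move=> iG i1 g; exists (psi g^-1).
have cancel h h' : h * h' = 1 -> naturally_iso (fcomp (psi h) (psi h')) (fid W).
  move=> e; apply: naturally_iso_trans i1.
  by rewrite -e; exists (Gamma h h').
split; last exact: cancel (mulgV g).
by apply: naturally_iso_sym; apply: cancel; rewrite mulVg.
Qed.

Lemma sval_cast_cod (C : strict3cat) (x : obj C) (A : arr1 C) (a b b' : Tr2 x A)
    (e : b = b') (m : Hom a b) : proj1_sig (cast_cod e m) = proj1_sig m.
Proof. by case: b' / e. Qed.

Section CategoricalAction.
Variables (G : groupType) (C : strict3cat) (r : threerep G C).
Hypothesis hr : strictly_unital r.
Variable f : G.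
Notation x := (rep_obj r).
Notation ρ := (rho r).
Notation W := (Tr2_rho r f).
Notation K := (centralizer f).
Notation val := (@centralizer_val G f).
Local Open Scope arr3_scope.

Lemma centralizer_comm (g : K) : val g * f = f * val g.
Proof. by case: g => g /= gf; apply/eqP. Qed.

Definition psi_ob (g : K) (w : W) : W :=
  exist _ _ (psi_hom2 hr (centralizer_comm g) (proj2_sig w)).

Lemma trace3_hom (w w' : W) (m : Hom w w') : trace3 r f (proj1_sig m).
Proof.
case: m => T [sT tT] /=.
rewrite /trace3 -dom1_id_src3 -cod1_id_src3 sT; exact: trace3_id (proj2_sig w).
Qed.

Lemma psi_mor_subproof (g : K) (w w' : W) (m : Hom w w') :
  hom3 (proj1_sig (psi_ob g w)) (proj1_sig (psi_ob g w')) (psi_arr3 r f (val g) (proj1_sig m)).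
Proof.
have tm := trace3_hom m; case: m tm => T [sT tT] /= tm.
by split; [rewrite psi_src // sT | rewrite psi_tgt // tT].
Qed.
Definition psi_mor (g : K) (w w' : W) (m : Hom w w') : Hom (psi_ob g w) (psi_ob g w') :=
  exist _ _ (psi_mor_subproof g m).

Lemma psi_mor_id g w : psi_mor g (idm w) = idm (psi_ob g w).
Proof. by apply: tr_hom_eq; rewrite /= psi_id //; exact: (proj2_sig w). Qed.
Lemma psi_mor_comp g (a b c : W) (m : Hom b c) (n : Hom a b) :
  psi_mor g (Defs.comp m n) = Defs.comp (psi_mor g m) (psi_mor g n).
Proof.
apply: tr_hom_eq => /=; apply: psi_comp2 => //; first exact: trace3_hom.
by case: m n => [T [sT tT]] [U [sU tU]] /=; rewrite tU sT.
Qed.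
Definition psi_functor (g : K) : functor W W := Functor (psi_mor_id g) (@psi_mor_comp g).

Lemma Gamma_subproof (h g : K) (w : W) :
  hom3 (proj1_sig (psi_ob h (psi_ob g w))) (proj1_sig (psi_ob (h * g)%g w))
    (Gamma_arr3 r f (val h) (val g) (proj1_sig w)).
Proof.
split; first by rewrite (Gamma_src hr) //; exact: centralizer_comm.
by rewrite (Gamma_tgt hr).
Qed.
Definition Gamma_mor (h g : K) (w : W) :
    Hom (fcomp (psi_functor h) (psi_functor g) w) (psi_functor (h * g)%g w) :=
  exist _ _ (Gamma_subproof h g w).
Lemma Gamma_mor_nat (h g : K) (a b : W) (m : Hom a b) :
  Defs.comp (Gamma_mor h g b) (fmap (fcomp (psi_functor h) (psi_functor g)) m)
  = Defs.comp (fmap (psi_functor (h * g)%g) m) (Gamma_mor h g a).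
Proof. by apply: tr_hom_eq; apply: Gamma_nat => //; exact: centralizer_comm. Qed.
Definition Gamma_trans (h g : K) := NatTrans (Gamma_mor_nat h g).

Lemma tr_iso (a b : W) (m : Hom a b) : (exists R, inverse3 (proj1_sig m) R) -> is_iso m.
Proof.
move=> [R]; case: m => T [sT tT] /= [[sR tR] TR RT]; rewrite sT tT in sR tR TR RT.
by exists (exist _ R (conj sR tR)); split; apply: tr_hom_eq.
Qed.

Lemma Gamma_natiso h g : is_natiso (Gamma_trans h g).
Proof. by move=> w; apply: tr_iso; exact: Gamma_inverse. Qed.

Lemma Gamma_trans_assoc k h g (w : W) :
  Defs.comp (Gamma_trans k (h * g)%g w) (fmap (psi_functor k) (Gamma_trans h g w)) =
  cast_cod (congr1 (fun j => psi_functor j w) (esym (mulgA k h g)))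
    (Defs.comp (Gamma_trans (k * h)%g g w) (Gamma_trans k h (psi_functor g w))).
Proof.
apply: tr_hom_eq; rewrite sval_cast_cod /=.
by apply: Gamma_assoc => //; exact: centralizer_comm.
Qed.

Lemma comp2_right_cancel (S S' T T' : arr3 C) : inverse3 T T' ->
  tgt3 S = src3 T -> tgt3 S' = src3 T -> S #2 T = S' #2 T -> S = S'.
Proof.
move=> [[sT' tT'] TT' _] st st' e.
by rewrite -[S](comp2_id st) -[S'](comp2_id st') -TT' -!comp2A ?sT' // e.
Qed.

Lemma unit_cell1 : id3 (unit_cell r 1) = id3 (id2 (ρ 1)).
Proof.
apply: hinv_uniq (hinv_unit_cell r 1) _.
by rewrite invg1 (phi_g1 hr); exact: hinv_id2.
Qed.

Lemma psi_one (T : arr3 C) : trace3 r f T -> psi_arr3 r f 1 T = T.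
Proof.
move=> tT; have eT := trace3_endo tT; have [dT cT] := tT.
rewrite /psi_arr3 unit_cell1 invg1 mul1g (phi_g1 hr) (phi_1g hr) (rho_1 hr).
rewrite (@comp0_id _ x); last by boundary.
rewrite (@id_comp0 _ x) // (@comp0_id _ x); last by boundary.
by rewrite id_comp1 // !comp1_id.
Qed.

Lemma psi_ob_one (w : W) : proj1_sig (psi_ob 1%g w) = proj1_sig w.
Proof.
apply: id3_inj; rewrite -[LHS]psi_id ?psi_one //; last exact: (proj2_sig w).
exact: trace3_id (proj2_sig w).
Qed.

Lemma trace3_Gamma (h g : K) (w : W) :
  trace3 r f (Gamma_arr3 r f (val h) (val g) (proj1_sig w)).
Proof. exact: trace3_hom (Gamma_mor h g w). Qed.

Lemma iota_subproof (w : W) :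
  hom3 (proj1_sig (psi_ob 1%g w)) (proj1_sig w) (Gamma_arr3 r f 1 1 (proj1_sig w)).
Proof.
have [src tgt] := Gamma_subproof 1%g 1%g w; split.
  by rewrite [LHS]src psi_ob_one.
by rewrite [LHS]tgt mulg1 psi_ob_one.
Qed.
Definition iota_mor (w : W) : Hom (psi_functor 1%g w) (fid W w) :=
  exist _ _ (iota_subproof w).
Lemma iota_nat (a b : W) (m : Hom a b) :
  Defs.comp (iota_mor b) (fmap (psi_functor 1%g) m)
  = Defs.comp (fmap (fid W) m) (iota_mor a).
Proof.
apply: tr_hom_eq => /=; have tm := trace3_hom m.
rewrite -[psi_arr3 _ _ _ _](psi_one (T := psi_arr3 r f 1 (proj1_sig m))).
  by rewrite (Gamma_nat hr) ?mulg1 ?mul1g ?psi_one.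
by rewrite psi_one.
Qed.
Definition iota_trans := NatTrans iota_nat.
Lemma iota_natiso : is_natiso iota_trans.
Proof. by move=> w; apply: tr_iso; exact: Gamma_inverse. Qed.

(** Associativity at [k = h = 1] reads
    [Gamma_{1,g} #2 Gamma_{1,g} = Gamma_{1,1} #2 Gamma_{1,g}], since [psi_1] is
    the identity. *)
Lemma Gamma_1g (g : K) (w : W) :
  Gamma_arr3 r f 1 (val g) (proj1_sig w)
  = Gamma_arr3 r f 1 1 (psi_arr2 r f (val g) (proj1_sig w)).
Proof.
have [R hR] := Gamma_inverse hr 1 (val g) w.
have src : src3 (Gamma_arr3 r f 1 (val g) (proj1_sig w)) = psi_arr2 r f (val g) (proj1_sig w).
  rewrite (Gamma_src hr) ?centralizer_comm //.
  exact: psi_ob_one (psi_ob g w).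
apply: (comp2_right_cancel hR).
- by rewrite (Gamma_tgt hr) src mul1g.
- rewrite src; have := Gamma_tgt hr 1 1 (psi_ob g w) => /= ->.
  by rewrite mul1g; exact: psi_ob_one (psi_ob g w).
have := Gamma_assoc hr 1 (h := 1) w _ (centralizer_comm g).
rewrite !mul1g mulg1 => /(_ erefl) <-.
by rewrite psi_one //; exact: (trace3_Gamma 1%g g w).
Qed.

(** Associativity at [h = g = 1], with [k] the given element, and cancellation
    of [Gamma_{g,1}]. *)
Lemma Gamma_g1 (g : K) (w : W) :
  Gamma_arr3 r f (val g) 1 (proj1_sig w)
  = psi_arr3 r f (val g) (Gamma_arr3 r f 1 1 (proj1_sig w)).
Proof.
have [R hR] := Gamma_inverse hr (val g) 1 w.
have src : src3 (Gamma_arr3 r f (val g) 1 (proj1_sig w)) = psi_arr2 r f (val g) (proj1_sig w).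
  rewrite (Gamma_src hr) ?mulg1 ?mul1g //.
  by congr (psi_arr2 _ _ _ _); exact: psi_ob_one.
apply: (comp2_right_cancel hR).
- by rewrite (Gamma_tgt hr) src mulg1.
- rewrite src psi_tgt; last exact: (trace3_Gamma 1%g 1%g w).
  rewrite (Gamma_tgt hr) mulg1.
  by congr (psi_arr2 _ _ _ _); exact: psi_ob_one.
have := Gamma_assoc hr (val g) (h := 1) (g := 1) w.
rewrite !mul1g !mulg1 => /(_ erefl erefl) ->.
have -> : psi_arr2 r f 1 (proj1_sig w) = proj1_sig w by exact: psi_ob_one.
by [].
Qed.

Lemma psi_action : is_categorical_action Gamma_trans.
Proof.
split.
- apply: (action_equivalence Gamma_natiso).
  by exists iota_trans; exact: iota_natiso.
- exact: Gamma_natiso.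
- exact: Gamma_trans_assoc.
exists iota_trans; split; first exact: iota_natiso.
  by move=> g w; apply: tr_hom_eq; rewrite sval_cast_cod; exact: Gamma_1g.
by move=> g w; apply: tr_hom_eq; rewrite sval_cast_cod; exact: Gamma_g1.
Qed.
End CategoricalAction.

Theorem theorem3p1 (G : groupType) (C : strict3cat) (r : threerep G C)
    (hr : strictly_unital r) (f : G) :
  exists (psi : centralizer f -> functor (Tr2_rho r f) (Tr2_rho r f))
         (Gamma : forall h g : centralizer f,
            nattrans (fcomp (psi h) (psi g)) (psi (h * g))),
    [/\ forall g (w : Tr2_rho r f),
          proj1_sig (psi g w) = psi_arr2 r f (centralizer_val g) (proj1_sig w),
        forall g (w w' : Tr2_rho r f) (m : Hom w w'),
          proj1_sig (fmap (psi g) m) = psi_arr3 r f (centralizer_val g) (proj1_sig m),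
        forall h g (w : Tr2_rho r f),
          proj1_sig (Gamma h g w) =
          Gamma_arr3 r f (centralizer_val h) (centralizer_val g) (proj1_sig w)
      & is_categorical_action Gamma].
Proof.
exists (psi_functor hr (f := f)), (Gamma_trans hr (f := f)); split=> //.
exact: psi_action.
Qed.
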